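(* Let $T:\mathcal{H}^\infty\subset D(T)\subseteq L^2(\mathbb{Z}_p)\to L^2(\mathbb{Z}_p)$ be a densely defined linear operator. Then $T\in Op(\tilde S^0_{0,0}(\mathbb{Z}_p\times\widehat{\mathbb{Z}}_p))$ if and only if $T\in\bigcap_{r\ge0}\mathcal{S}_r(\mathbb{Z}_p)$. That is, $$Op(\tilde S^0_{0,0}(\mathbb{Z}_p\times\widehat{\mathbb{Z}}_p))=\bigcap_{r\ge0}\mathcal{S}_r(\mathbb{Z}_p).$$
   Context: Let $p$ be a fixed prime, $\mathbb{N}_0=\{0,1,2,\dots\}$, $\mathbb{Z}_p$ the compact group of $p$-adic integers with normalised Haar measure $dx$, and $\widehat{\mathbb{Z}}_p\cong\mathbb{Q}_p/\mathbb{Z}_p$ its dual group. For $\xi\in\widehat{\mathbb{Z}}_p$, $\xi\ne0$, $|\xi|_p$ is the $p$-adic absolute value of any representative; $|0|_p:=0$. Put $\langle\xi\rangle:=\max\{1,|\xi|_p\}$, $\chi_p(\xi x):=e^{2\pi i\{\xi x\}_p}$ (with $\{\cdot\}_p$ the $p$-adic fractional part), $\widehat f(\xi):=\int_{\mathbb{Z}_p}f(x)\overline{\chi_p(\xi x)}dx$, and $\mathcal{H}^\infty:=\mathrm{Span}\{\chi_p(\xi x)\}_{\xi\in\widehat{\mathbb{Z}}_p}$. The symbol of a densely defined linear operator $T$ with $\mathcal{H}^\infty\subset D(T)$ is $\sigma_T(x,\xi):=\overline{\chi_p(\xi x)}\,T(\chi_p(\xi\,\cdot))(x)$, and $T$ is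 thought of as the operator given by its symbol; the pseudo-differential operator with symbol $\sigma$ is $T_\sigma f(x)=\sum_{\xi\in\widehat{\mathbb{Z}}_p}\sigma(x,\xi)\widehat f(\xi)\chi_p(\xi x)$. The Vladimirov operator $D^\beta$, $\beta>0$, is the Fourier multiplier with symbol $|\xi|_p^\beta+\frac{1-p^{-1}}{1-p^{-(\beta+1)}}(1-\delta_{\xi,0})$, where $\delta_{\xi,0}$ is the Kronecker delta, and $D^0$ is the identity; $D^\beta_x$ acts in the variable $x$. For $m\in\mathbb{R}$, $0\le\delta\le\rho\le1$, $\tilde S^m_{\rho,\delta}(\mathbb{Z}_p\times\widehat{\mathbb{Z}}_p)$ is the collection of measurable $\sigma:\mathbb{Z}_p\times\widehat{\mathbb{Z}}_p\to\mathbb{C}$ such that, for all $\alpha,\beta\in\mathbb{N}_0$, the estimate $$|D_x^\beta(\sigma(x,\xi+\eta)-\sigma(x,\xi))|\le C_{\sigma,m,\alpha,\beta}\,|\eta|_p^\alpha\langle\xi\rangle^{m-\rho\alpha+\delta\beta}$$ holds for some $C_{\sigma,m,\alpha,\beta}>0$ and any $(x,\xi,\eta)\in\mathbb{Z}_p\times\widehat{\mathbb{Z}}_p\times\widehat{\mathbb{Z}}_p$ with $|\eta|_p\le\langle\xi\rangle$. $Op(\tilde S^m_{\rho,\delta})$ is the class of pseudo-differential operators with symbol in $\tilde S^m_{\rho,\delta}$. The associated matrix of $T$ is $(M_T)_{\xi\eta}:=(T\chi_p(\eta\,\cdot),\chi_p(\xi\,\cdot))_{L^2(\mathbb{Z}_p)}$,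 $\xi,\eta\in\widehat{\mathbb{Z}}_p$. For $r\ge0$, a matrix $M$ indexed by $\widehat{\mathbb{Z}}_p$ is in the Schur class $\mathcal{S}_r(\widehat{\mathbb{Z}}_p)$ if $$\max\Big\{\sup_{\xi}\sum_{\eta}|M_{\eta\xi}|\langle\eta-\xi\rangle^r,\ \sup_{\eta}\sum_{\xi}|M_{\eta\xi}|\langle\eta-\xi\rangle^r\Big\}<\infty .$$ $\mathcal{S}_r(\mathbb{Z}_p)$ is the class of densely defined linear operators $T:\mathcal{H}^\infty\subset D(T)\subseteq L^2(\mathbb{Z}_p)\to L^2(\mathbb{Z}_p)$ with $M_T\in\mathcal{S}_r(\widehat{\mathbb{Z}}_p)$.
   Formalization: The symbol class also requires |D_x^β σ(x,ξ)| ≤ C⟨ξ⟩^{m+δβ} for all β; with difference estimates only, σ(x,ξ)=g(x), g in L² with non-summable Fourier coefficients, lies in the class but its operator is not in S_0. *)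

(* Defs.v *)
From HB Require Import structures.
From mathcomp Require Import all_boot all_order all_algebra.
From mathcomp Require Import complex.
From mathcomp Require Import all_classical all_reals all_analysis.
Set Implicit Arguments.
Unset Strict Implicit.
Unset Printing Implicit Defensive.
Import Order.TTheory GRing.Theory Num.Theory.
Local Open Scope classical_set_scope.
Local Open Scope ring_scope.

(* Z_p as the inverse limit of the Z/p^n: [res x n] is the representative of
   x mod p^n in {0, ..., p^n - 1}; the equation at n and n.+1 forces both the
   compatibility and the range. *)
Record padic_int (p : nat) := MkPadicInt {
  res :> nat -> int ;
  res_mod : forall n, res n = (res n.+1 %% (p ^ n)%N%:Z)%Z }.

HB.instance Definition _ p := gen_eqMixin (padic_int p).
HB.instance Definition _ p := gen_choiceMixin (padic_int p).

Section PadicIntGroup.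
Variable p : nat.
Implicit Types x y z : padic_int p.

Lemma pint_eq x y : (forall n, x n = y n) -> x = y.
Proof.
case: x y => [x xP] [y yP] /= xy.
have exy : x = y by apply/funext.
by rewrite exy in xP *; congr MkPadicInt; exact: Prop_irrelevance.
Qed.

Lemma modz_pow_succ (a : int) n :
  ((a %% (p ^ n.+1)%N%:Z)%Z %% (p ^ n)%N%:Z)%Z = (a %% (p ^ n)%N%:Z)%Z.
Proof.
by rewrite [in RHS](divz_eq a (p ^ n.+1)%N%:Z) [in X in X + _]expnS PoszM mulrA
  modzMDl.
Qed.

Lemma res_modK x n : (x n %% (p ^ n)%N%:Z)%Z = x n.
Proof. by rewrite [in LHS]res_mod modz_mod -res_mod. Qed.

Fact pint_zero_subproof n : (0 : int) = (0 %% (p ^ n)%N%:Z)%Z.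
Proof. by rewrite mod0z. Qed.
Definition pint_zero : padic_int p :=
  @MkPadicInt p (fun=> 0) pint_zero_subproof.

Fact pint_add_subproof x y n :
  ((x n + y n) %% (p ^ n)%N%:Z)%Z =
  (((x n.+1 + y n.+1) %% (p ^ n.+1)%N%:Z)%Z %% (p ^ n)%N%:Z)%Z.
Proof. by rewrite modz_pow_succ (res_mod x) (res_mod y) modzDm. Qed.
Definition pint_add x y : padic_int p :=
  @MkPadicInt p _ (pint_add_subproof x y).

Fact pint_opp_subproof x n :
  ((- x n) %% (p ^ n)%N%:Z)%Z =
  (((- x n.+1) %% (p ^ n.+1)%N%:Z)%Z %% (p ^ n)%N%:Z)%Z.
Proof. by rewrite modz_pow_succ (res_mod x) modzNm. Qed.
Definition pint_opp x : padic_int p := @MkPadicInt p _ (pint_opp_subproof x).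

Fact pint_addA : associative pint_add.
Proof.
by move=> x y z; apply: pint_eq => n /=; rewrite modzDml modzDmr addrA.
Qed.
Fact pint_addC : commutative pint_add.
Proof. by move=> x y; apply: pint_eq => n /=; rewrite addrC. Qed.
Fact pint_add0 : left_id pint_zero pint_add.
Proof. by move=> x; apply: pint_eq => n /=; rewrite add0r res_modK. Qed.
Fact pint_addN : left_inverse pint_zero pint_opp pint_add.
Proof. by move=> x; apply: pint_eq => n /=; rewrite modzDml addNr mod0z. Qed.

HB.instance Definition _ :=
  GRing.isZmodule.Build (padic_int p) pint_addA pint_addC pint_add0 pint_addN.
HB.instance Definition _ := isPointed.Build (padic_int p) 0.

(* The balls a + p^n Z_p form a countable base of clopen sets, so the
   sigma-algebra they generate is the Borel one. *)
Definition pint_balls : set (set (padic_int p)) :=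
  [set [set x : padic_int p | x a.2 = a.1 a.2] | a in [set: padic_int p * nat]].

HB.instance Definition _ :=
  Measurable.copy (padic_int p) (g_sigma_algebraType pint_balls).

End PadicIntGroup.

Definition frac_part (q : rat) : rat := q - (Num.floor q)%:~R.

(* The dual group Q_p / Z_p = Z[1/p] / Z, each class being given by its
   representative in Z[1/p] `&` [0, 1). *)
Definition pdual_pred (p : nat) : pred rat := fun q =>
  `[< exists k : nat, (p ^ k)%:R * q \is a Num.int >] && (0 <= q < 1).

Record pdual (p : nat) := MkDual { dval : rat ; dvalP : pdual_pred p dval }.

HB.instance Definition _ p := [isSub for @dval p].
HB.instance Definition _ p := [Countable of pdual p by <:].

Lemma frac_itv q : 0 <= frac_part q < 1.
Proof.
by rewrite /frac_part subr_ge0 floor_le_tmp ltrBlDr addrC -intrD1 floorD1_gt.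
Qed.

Lemma frac_id q : 0 <= q < 1 -> frac_part q = q.
Proof. by move=> ?; rewrite /frac_part (@floor_def _ q 0) ?subr0. Qed.

Lemma fracDz q z : frac_part (q + z%:~R) = frac_part q.
Proof.
by rewrite /frac_part floorDrz ?intr_int// intrKfloor intrD opprD addrACA subrr
  addr0.
Qed.

Lemma fracDl q r : frac_part (frac_part q + r) = frac_part (q + r).
Proof. by rewrite {2}/frac_part addrAC -mulrNz fracDz. Qed.

Lemma fracDr q r : frac_part (q + frac_part r) = frac_part (q + r).
Proof. by rewrite addrC fracDl addrC. Qed.

Section DualGroup.
Variable p : nat.
Implicit Types x y z : pdual p.

Fact frac_dual q :
  (exists k : nat, (p ^ k)%:R * q \is a Num.int) -> pdual_pred p (frac_part q).
Proof.
case=> k kq; rewrite /pdual_pred frac_itv andbT; apply/asboolP; exists k.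
by rewrite /frac_part mulrBr rpredB // rpredM // ?intr_int // natr_int.
Qed.

Fact dval_pow x : exists k : nat, (p ^ k)%:R * dval x \is a Num.int.
Proof. by case: x => q /= /andP[/asboolP]. Qed.

Fact dval_itv x : 0 <= dval x < 1.
Proof. by case: x => q /= /andP[]. Qed.

Fact pdual_zero_subproof : pdual_pred p 0.
Proof. by apply/andP; split=> //; apply/asboolP; exists 0%N; rewrite mulr0. Qed.
Definition pdual_zero : pdual p := MkDual pdual_zero_subproof.

Fact pdual_add_subproof x y : pdual_pred p (frac_part (dval x + dval y)).
Proof.
apply: frac_dual; have [[k xk] [l yl]] := (dval_pow x, dval_pow y).
exists (k + l)%N; rewrite mulrDr expnD natrM rpredD //.
  by rewrite mulrAC rpredM // natr_int.
by rewrite -mulrA rpredM // natr_int.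
Qed.
Definition pdual_add x y : pdual p := MkDual (pdual_add_subproof x y).

Fact pdual_opp_subproof x : pdual_pred p (frac_part (- dval x)).
Proof.
by apply: frac_dual; have [k xk] := dval_pow x; exists k; rewrite mulrN rpredN.
Qed.
Definition pdual_opp x : pdual p := MkDual (pdual_opp_subproof x).

Fact pdual_addA : associative pdual_add.
Proof. by move=> x y z; apply: val_inj; rewrite /= fracDl fracDr addrA. Qed.
Fact pdual_addC : commutative pdual_add.
Proof. by move=> x y; apply: val_inj; rewrite /= addrC. Qed.
Fact pdual_add0 : left_id pdual_zero pdual_add.
Proof. by move=> x; apply: val_inj; rewrite /= add0r frac_id ?dval_itv. Qed.
Fact pdual_addN : left_inverse pdual_zero pdual_opp pdual_add.
Proof. by move=> x; apply: val_inj; rewrite /= fracDl addNr frac_id. Qed.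

HB.instance Definition _ :=
  GRing.isZmodule.Build (pdual p) pdual_addA pdual_addC pdual_add0 pdual_addN.
HB.instance Definition _ := isPointed.Build (pdual p) 0.
HB.instance Definition _ := @isMeasurable.Build default_measure_display
  (pdual p) discrete_measurable discrete_measurable0
  discrete_measurableC discrete_measurableU.

End DualGroup.

Section PseudoDifferential.
Variables (R : realType) (p : nat).
Implicit Types (f g : padic_int p -> R[i]) (x : padic_int p).
Implicit Types (xi eta : pdual p).

Definition padic_abs (q : rat) : R :=
  if q == 0 then 0
  else (p ^ logn p `|denq q|%N)%:R / (p ^ logn p `|numq q|%N)%:R.

Definition pdual_abs xi : R := padic_abs (dval xi).

Definition bracket xi : R := Num.max 1 (pdual_abs xi).

(* If p^k is the denominator of xi, then xi * x = xi * (x mod p^k) modulo Z_p,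
   so the p-adic fractional part of xi * x is that of a number in Z[1/p]. *)
Definition frac_pairing xi x : rat :=
  frac_part (dval xi * (x (logn p `|denq (dval xi)|%N))%:~R).

Definition chi xi x : R[i] :=
  let t := 2 * pi * ratr (frac_pairing xi x) in (cos t +i* sin t)%C.

Definition cmod (z : R[i]) : R := Normc.normc z.

Definition cmeasurable d (X : measurableType d) (f : X -> R[i]) : Prop :=
  measurable_fun [set: X] (fun u => complex.Re (f u)) /\
  measurable_fun [set: X] (fun u => complex.Im (f u)).

Section Haar.
Variable mu : probability (padic_int p) R.

Definition is_haar : Prop :=
  forall (a : padic_int p) (A : set (padic_int p)), measurable A ->
    mu [set a + x | x in A] = mu A.

Definition cintegral f : R[i] :=
  (Rintegral mu setT (fun x => complex.Re (f x)) +i*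
   Rintegral mu setT (fun x => complex.Im (f x)))%C.

Definition ae_equal f g : Prop := {ae mu, forall x, f x = g x}.

(* Elements of L^2 are handled as functions, to be compared with [ae_equal]. *)
Definition L2 : set (padic_int p -> R[i]) := [set f | cmeasurable f /\
  (\int[mu]_x ((cmod (f x)) ^+ 2)%:E < +oo)%E].

Definition inner f g : R[i] := cintegral (fun x => f x * (g x)^*).

Definition fourier f xi : R[i] := cintegral (fun x => f x * (chi xi x)^*).

Definition Hinf : set (padic_int p -> R[i]) :=
  [set f | exists s : seq (R[i] * pdual p),
    f = fun x => \sum_(c <- s) c.1 * chi c.2 x].

Record dd_operator := DDOperator {
  op_dom : set (padic_int p -> R[i]) ;
  op_act :> (padic_int p -> R[i]) -> (padic_int p -> R[i]) ;
  op_dom_L2 : op_dom `<=` L2 ;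
  op_dom_ae : forall f g, op_dom f -> L2 g -> ae_equal f g -> op_dom g ;
  op_dom_linear : forall (a : R[i]) f g, op_dom f -> op_dom g ->
    op_dom (fun x => a * f x + g x) ;
  op_dom_Hinf : Hinf `<=` op_dom ;
  op_dom_dense : forall f (e : R), L2 f -> 0 < e -> exists2 g, op_dom g &
    (\int[mu]_x ((cmod (f x - g x)) ^+ 2)%:E < e%:E)%E ;
  op_act_L2 : forall f, op_dom f -> L2 (op_act f) ;
  op_act_ae : forall f g, op_dom f -> op_dom g -> ae_equal f g ->
    ae_equal (op_act f) (op_act g) ;
  op_act_linear : forall (a : R[i]) f g, op_dom f -> op_dom g ->
    ae_equal (op_act (fun x => a * f x + g x))
             (fun x => a * op_act f x + op_act g x) }.

Definition vladimirov_symbol (b : R) xi : R :=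
  pdual_abs xi `^ b +
  (1 - p%:R^-1) / (1 - p%:R `^ (- (b + 1))) * (1 - (xi == 0)%:R).

(* [is_vladimirov b f g]: f is in the domain of D^b and g represents D^b f.
   For b != 0 this is the Fourier multiplier on L^2, which determines g up to
   a null set only. *)
Definition is_vladimirov (b : R) f g : Prop :=
  if b == 0 then g = f
  else [/\ L2 f, L2 g &
    forall xi, fourier g xi = (vladimirov_symbol b xi)%:C%C * fourier f xi].

Definition vladimirov_le (b : R) f (C : R) : Prop :=
  exists2 g, is_vladimirov b f g & forall x, cmod (g x) <= C.

(* The first family of estimates holds trivially, whatever sigma (., 0) is, for
   a symbol that does not depend on xi (a multiplication operator).  The second
   family is the usual order-zero estimate of Hoermander classes, where the
   zeroth-order difference of a symbol is the symbol itself. *)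
Definition symbol_class (m rho delta : R) :
    set (padic_int p -> pdual p -> R[i]) :=
  [set sigma | [/\
    cmeasurable (fun z : padic_int p * pdual p => sigma z.1 z.2),
    forall alpha beta : nat, exists2 C : R, 0 < C &
      forall xi eta, pdual_abs eta <= bracket xi ->
        vladimirov_le beta%:R (fun x => sigma x (xi + eta) - sigma x xi)
          (C * pdual_abs eta ^+ alpha *
           bracket xi `^ (m - rho * alpha%:R + delta * beta%:R)) &
    forall beta : nat, exists2 C : R, 0 < C &
      forall xi, vladimirov_le beta%:R (fun x => sigma x xi)
          (C * bracket xi `^ (m + delta * beta%:R))]].

(* The sum is over all of the dual group; it has finite support when f is in
   [Hinf], the only case in which it is used. *)
Definition pseudo_diff (sigma : padic_int p -> pdual p -> R[i]) f x : R[i] :=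
  \sum_(xi \in [set: pdual p]) sigma x xi * fourier f xi * chi xi x.

Definition Op (S : set (padic_int p -> pdual p -> R[i])) : set dd_operator :=
  [set T | exists2 sigma, S sigma &
    forall f, Hinf f -> ae_equal (T f) (pseudo_diff sigma f)].

Definition assoc_matrix (T : dd_operator) xi eta : R[i] :=
  inner (T (chi eta)) (chi xi).

Definition schur_matrix (r : R) (M : pdual p -> pdual p -> R[i]) : Prop :=
  (maxe
    (ereal_sup (range (fun xi => \esum_(eta in [set: pdual p])
       (cmod (M eta xi) * bracket (eta - xi) `^ r)%:E)))
    (ereal_sup (range (fun eta => \esum_(xi in [set: pdual p])
       (cmod (M eta xi) * bracket (eta - xi) `^ r)%:E))) < +oo)%E.

Definition schur_class (r : R) : set dd_operator :=
  [set T | schur_matrix r (assoc_matrix T)].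

End Haar.
End PseudoDifferential.

Arguments schur_class {R p} mu r _.
Arguments Op {R p} mu S _.

(* Main.v *)
(* If [sigma] is the symbol of [T], then [M_T xi eta] is the Fourier coefficient
   of [sigma (., eta)] at [xi - eta].  A bound on [D^b sigma (., eta)] makes this
   coefficient [O(<xi - eta>^-b)], and [<zeta>^-2] is summable over the dual group,
   which gives every Schur bound.  Conversely, the Schur bounds say that for each
   [b] the coefficients [M_T (xi + zeta) xi], weighted by [<zeta>^b], are
   absolutely summable in [zeta], uniformly in [xi]; the Fourier series with these
   coefficients is then a symbol of [T], because Fourier coefficients determine an
   integrable function up to a null set, and each [D^b] can be applied termwise.
   As [|eta| >= 1] for [eta <> 0], the estimates on differences follow from those
   on the symbol. *)
Require Import Defs.
From mathcomp Require Import all_boot all_order all_algebra.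
From mathcomp Require Import complex.
From mathcomp Require Import all_classical all_reals all_analysis.
From mathcomp Require Import measurable_realfun lra ring.
Set Implicit Arguments.
Unset Strict Implicit.
Unset Printing Implicit Defensive.
Import Order.TTheory GRing.Theory Num.Theory.
Import numFieldNormedType.Exports.
Local Open Scope classical_set_scope.
Local Open Scope ring_scope.

(** The estimates of the symbol class hold at every point, with [D^0] the identity, whereas
    [T (chi xi)] is known only up to a null set. The product of [T (chi xi)] and the conjugate of
    [chi xi] therefore cannot serve as the symbol as it stands: it is replaced by its Fourier
    series, whose absolute convergence gives a bound everywhere. Fourier coefficients determine a
    function because the indicator of a ball of level [n] is a combination of the [p ^ n] characters
    of that level: vanishing coefficients make the integral over every ball vanish, and balls
    generate the sigma-algebra. The summability of [<zeta>^-2] comes from counting: there are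
    [p ^ n] characters of level at most [n]. *)

(** * The character exp(2 pi i q) of the rationals and sums of roots of unity *)

Section Exponential.
Variable R : realType.

(** The body repeats that of [chi], so that [chi] is by unfolding [expi] of [frac_pairing]. *)
Definition expi (q : rat) : R[i] :=
  let t := 2 * pi * ratr q in (cos t +i* sin t)%C.

Lemma expiD q r : expi (q + r) = expi q * expi r.
Proof.
rewrite /expi rmorphD mulrDr cosD sinD; apply/eqP.
by rewrite eq_complex /= eqxx /= [X in _ == X]addrC eqxx.
Qed.

Lemma expi0 : expi 0 = 1.
Proof. by rewrite /expi rmorph0 mulr0 cos0 sin0. Qed.

Lemma cmod_expi q : cmod (expi q) = 1.
Proof. by rewrite /cmod /expi /= cos2Dsin2 sqrtr1. Qed.

Lemma expi_nat n : expi n%:R = 1.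
Proof.
elim: n => [|n IHn]; first exact: expi0.
rewrite -addn1 natrD expiD IHn mul1r /expi rmorph1 mulr1 mulr_natl.
by rewrite cos2pi sin2pi.
Qed.

Lemma expiNK q : expi (- q) * expi q = 1.
Proof. by rewrite -expiD addNr expi0. Qed.

Lemma expi_int q : q \is a Num.int -> expi q = 1.
Proof.
case/intrP=> -[n|n] ->; first exact: expi_nat.
by rewrite -[LHS]mulr1 NegzE mulrNz -[X in _ * X](expi_nat n.+1) expiNK.
Qed.

Lemma expiD_int q r : r \is a Num.int -> expi (q + r) = expi q.
Proof. by move=> ri; rewrite expiD (expi_int ri) mulr1. Qed.

Lemma expi_frac q : expi (frac_part q) = expi q.
Proof.
by rewrite /frac_part expiD_int // rpredN intr_int.
Qed.

Lemma expiN q : expi (- q) = (expi q)^*.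
Proof.
by rewrite /expi rmorphN /= mulrN cosN sinN.
Qed.

(** Modulo integers [q] becomes some t in [0, 1); if t > 0 then sin(pi t) > 0, and cos(2 pi t) = 1 -
    2 sin(pi t)^2 is less than 1. *)
Lemma expi_eq1 q : expi q = 1 -> q \is a Num.int.
Proof.
rewrite -expi_frac => q1.
have /andP[] := frac_itv q; rewrite le_eqVlt => /orP[/eqP q0 _|q0 ql1].
  move: q0; rewrite /frac_part => /esym/eqP; rewrite subr_eq0 => /eqP ->.
  exact: intr_int.
have q0R : 0 < ratr (frac_part q) :> R by rewrite ltr0q.
have q1R : ratr (frac_part q) < 1 :> R by rewrite -(rmorph1 (@ratr R)) ltr_rat.
move: q1; rewrite /expi; set t : R := ratr _ in q0R q1R * => /(congr1 (@complex.Re R)) /=.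
rewrite (_ : 2 * pi * t = (pi * t) *+ 2); last by rewrite -mulrA mulr_natl.
have : 0 < sin (pi * t).
  by apply: sin_gt0_pi; rewrite mulr_gt0 ?pi_gt0 //= gtr_pMr ?pi_gt0.
rewrite cos_mulr2n cos2sin2 mulr2n => s0.
have s2 : 0 < sin (pi * t) ^+ 2 by rewrite exprn_gt0.
set u := sin _ ^+ 2 in s2 *; move=> H.
suff : u <= 0 by rewrite leNgt s2.
by lra.
Qed.

Lemma expi_exp q n : expi q ^+ n = expi (q * n%:R).
Proof.
elim: n => [|n IHn]; first by rewrite mulr0 expi0.
by rewrite exprSr IHn -expiD -[in RHS]addn1 natrD mulrDr mulr1.
Qed.

(** This is a geometric sum of ratio z = exp(2 pi i a / N). As z^N = 1, the product of z - 1 and the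
    sum is 0, and z = 1 only if N divides a. *)
Lemma sum_expi (N : nat) (a : int) : (0 < N)%N ->
  \sum_(j < N) expi (j%:R / N%:R * a%:~R) =
  if (N%:Z %| a)%Z then N%:R else 0.
Proof.
move=> N0; have N0q : N%:R != 0 :> rat by rewrite pnatr_eq0 -lt0n.
under eq_bigr do rewrite -mulrA mulrC -expi_exp.
case: ifPn => [/dvdzP[b ->]|Na].
  rewrite (@expi_int (_ * _)).
    under eq_bigr do rewrite expr1n.
    by rewrite sumr_const card_ord.
  by rewrite rmorphM /= mulrC mulfK ?intr_int // .
have := subrX1 (expi (N%:R^-1 * a%:~R)) N.
rewrite expi_exp mulrAC mulVf // mul1r expi_int ?intr_int // subrr => /esym/eqP.
rewrite mulf_eq0 => /orP[|/eqP //]; rewrite subr_eq0 => /eqP/expi_eq1/intrP[b].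
move/(congr1 ( *%R N%:R)); rewrite mulrA divff // mul1r => ab.
case/negP: Na; apply/dvdzP; exists b; apply: (@intr_inj rat).
by rewrite ab rmorphM /= mulrC.
Qed.

Lemma int_num_mulz (q : rat) (a b : int) :
  b%:~R * q \is a Num.int -> q * (a * b)%:~R \is a Num.int.
Proof. by move=> bq; rewrite intrM mulrCA [q * _]mulrC rpredM ?intr_int. Qed.

End Exponential.

(** * Levels, absolute value and characters of the dual group; counting by level *)

Section Duals.
Variables (R : realType) (p : nat).
Hypothesis p_prime : prime p.
Implicit Types (x y : padic_int p) (xi eta : pdual p).

(** The level of [xi]: [chi xi] depends only on the argument modulo [p ^ dexp xi], and the bracket
    of [xi] is [p ^ dexp xi], also at 0. *)
Definition dexp xi : nat := logn p `|denq (dval xi)|%N.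

Let p0 : (0 < p)%N := prime_gt0 p_prime.
Let pX0 n : (p ^ n)%:R != 0 :> rat.
Proof. by rewrite pnatr_eq0 -lt0n expn_gt0 p0. Qed.

(** If [p ^ k] times the reduced fraction a/b is an integer, then b divides [p ^ k * a], hence
    [p ^ k] by coprimality, and a divisor of a prime power is a power of the prime. *)
Lemma denq_dual xi : `|denq (dval xi)|%N = (p ^ dexp xi)%N.
Proof.
have [k /intrP[a ka]] := dval_pow xi.
suff /(dvdn_pfactor _ _ p_prime)[m _ dm] : (`|denq (dval xi)| %| p ^ k)%N.
  by rewrite /dexp dm pfactorK.
rewrite -(@Gauss_dvdl _ _ `|numq (dval xi)|%N); last first.
  by rewrite coprime_sym coprime_num_den.
suff -> : (p ^ k * `|numq (dval xi)| = `|a| * `|denq (dval xi)|)%N.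
  exact: dvdn_mull.
rewrite -[(p ^ k)%N]absz_nat -!abszM; congr absz.
apply: (@intr_inj rat); rewrite !rmorphM /= -ka -mulrA; congr (_ * _).
by rewrite -{2}[dval xi]divq_num_den divfK // intr_eq0 denq_eq0.
Qed.

Lemma dval_dexp xi : (p ^ dexp xi)%:R * dval xi = (numq (dval xi))%:~R.
Proof.
rewrite -denq_dual -{2}[dval xi]divq_num_den mulrC pmulrn.
by rewrite absz_denq divfK // intr_eq0 denq_eq0.
Qed.

Lemma dexp_le xi n : (dexp xi <= n)%N -> (p ^ n)%:R * dval xi \is a Num.int.
Proof.
move=> /subnK <-; rewrite expnD natrM -mulrA dval_dexp.
by rewrite rpredM ?natr_int ?intr_int.
Qed.

Lemma dexp_eq0 xi : (dexp xi == 0%N) = (xi == 0).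
Proof.
apply/eqP/eqP => [xi0|->]; last first.
  have d0 : denq (dval (0 : pdual p)) = 1 by exact: (denq_int 0).
  by rewrite /dexp d0 logn1.
apply: val_inj => /=; have := dval_dexp xi; rewrite xi0 mul1r.
have := dval_itv xi => /[swap] ->; rewrite ler0z ltrz1 => /andP[a0 a1].
suff -> : numq (dval xi) = 0 by [].
by apply/eqP; rewrite eq_le a0 andbT -ltz1D addr0.
Qed.

(** For [xi != 0] the denominator is a positive power of [p], so the numerator, being coprime to it,
    contributes no power of [p]. *)
Lemma pdual_absE xi : pdual_abs R xi = if xi == 0 then 0 else (p ^ dexp xi)%:R.
Proof.
rewrite /pdual_abs /padic_abs.
have -> : (dval xi == 0) = (xi == 0) by rewrite -val_eqE.
case: ifPn => // xi0; rewrite -/(dexp xi) (_ : logn p _ = 0%N) ?divr1 //.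
apply/eqP; rewrite -leqn0 leqNgt logn_gt0 mem_primes negb_and p_prime /=.
rewrite negb_and -orbC; apply/orP; left; apply/negP => pn.
have := coprime_num_den (dval xi); rewrite denq_dual.
rewrite coprime_sym coprime_pexpl ?lt0n ?dexp_eq0 // prime_coprime //.
by rewrite pn.
Qed.

Lemma bracketE xi : bracket R xi = (p ^ dexp xi)%:R.
Proof.
rewrite /bracket pdual_absE; case: eqP => [->|_].
  have /eqP -> : dexp (0 : pdual p) == 0%N by rewrite dexp_eq0.
  by rewrite max_l.
by rewrite max_r // ler1n expn_gt0 p0.
Qed.

Lemma bracket_ge1 xi : 1 <= bracket R xi.
Proof. by rewrite /bracket le_max lexx. Qed.

Lemma pdual_abs_ge1 xi : xi != 0 -> 1 <= pdual_abs R xi.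
Proof.
by move=> /negPf xi0; rewrite pdual_absE xi0 ler1n expn_gt0 p0.
Qed.

Lemma pdual_abs_bracket xi : xi != 0 -> pdual_abs R xi = bracket R xi.
Proof. by move=> /negPf xi0; rewrite pdual_absE bracketE xi0. Qed.

Lemma res_mod_le x m n : (m <= n)%N -> x m = (x n %% (p ^ m)%N%:Z)%Z.
Proof.
elim: n => [|n IHn]; first by rewrite leqn0 => /eqP ->; rewrite res_modK.
rewrite leq_eqVlt => /orP[/eqP ->|]; first by rewrite res_modK.
rewrite ltnS => mn; rewrite (IHn mn) [x n]res_mod.
move: (x n.+1) => a; rewrite -(subnK mn) expnD PoszM.
by rewrite [in RHS](divz_eq a ((p ^ (n - m))%N%:Z * (p ^ m)%N%:Z)) mulrA modzMDl.
Qed.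

(** Passing to a finer residue changes it by a multiple of [p ^ dexp xi], which [dval xi] turns into
    an integer. Several characters can thus be compared at one common level. *)
Lemma chiE xi x n : (dexp xi <= n)%N -> chi R xi x = expi R (dval xi * (x n)%:~R).
Proof.
move=> dn; rewrite /chi /frac_pairing -/(dexp xi) -/(expi R _) expi_frac.
rewrite [in RHS](divz_eq (x n) (p ^ dexp xi)%N%:Z) -res_mod_le //.
rewrite intrD mulrDr addrC expiD_int //.
apply: (@int_num_mulz (dval xi)); exact: dexp_le.
Qed.

Lemma expi_modz (q : rat) (a : int) n : (p ^ n)%:R * q \is a Num.int ->
  expi R (q * (a %% (p ^ n)%N%:Z)%Z%:~R) = expi R (q * a%:~R).
Proof.
move=> qn; rewrite [in RHS](divz_eq a (p ^ n)%N%:Z).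
rewrite [in RHS]intrD mulrDr [in RHS]addrC expiD_int //.
exact: (@int_num_mulz q).
Qed.

Lemma chiDr xi x y : chi R xi (x + y) = chi R xi x * chi R xi y.
Proof.
rewrite !(@chiE _ _ (dexp xi)) // /= expi_modz ?dexp_le // -expiD -mulrDr.
by rewrite intrD.
Qed.

Lemma chiDl xi eta x : chi R (xi + eta) x = chi R xi x * chi R eta x.
Proof.
pose n := maxn (dexp (xi + eta)) (maxn (dexp xi) (dexp eta)).
rewrite !(@chiE _ _ n) ?leq_max ?leqnn ?orbT // -expiD -mulrDl /=.
by rewrite /frac_part mulrBl expiD_int // rpredN rpredM ?intr_int.
Qed.

Lemma cmod_chi xi x : cmod (chi R xi x) = 1.
Proof. by rewrite (@chiE _ _ (dexp xi)) // cmod_expi. Qed.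

Lemma chi0 x : chi R 0 x = 1.
Proof. by rewrite (@chiE _ _ (dexp 0)) //= mul0r expi0. Qed.

Lemma chiN xi x : chi R (- xi) x = (chi R xi x)^*.
Proof.
have cV : chi R (- xi) x * chi R xi x = 1 by rewrite -chiDl addNr chi0.
have cJ : (chi R xi x)^* * chi R xi x = 1.
  by rewrite (@chiE _ _ (dexp xi)) // -expiN -expiD addNr expi0.
have c0 : chi R xi x != 0.
  by apply/eqP => c0; move/eqP: cJ; rewrite c0 mulr0 eq_sym oner_eq0.
by apply: (mulIf c0); rewrite cV cJ.
Qed.

Lemma chi_oppr xi x : chi R xi (- x) = (chi R xi x)^*.
Proof.
rewrite !(@chiE _ _ (dexp xi)) //= expi_modz ?dexp_le //.
by rewrite -expiN mulrNz mulrN.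
Qed.

Lemma res_subr_eq0 x y n : ((x - y) n == 0) = (y n == x n).
Proof.
apply/eqP/eqP => [xy|yx]; last first.
  by rewrite /= -yx modzDmr subrr mod0z.
have -> : x n = (((x - y) n + y n) %% (p ^ n)%N)%Z by rewrite -[in LHS](subrK y x).
by rewrite xy add0r res_modK.
Qed.

Fact pint_one_subproof n : (1 %% (p ^ n)%N%:Z)%Z =
  ((1 %% (p ^ n.+1)%N%:Z)%Z %% (p ^ n)%N%:Z)%Z.
Proof. by rewrite modz_pow_succ. Qed.
(** The unit of the ring Z_p. It generates a dense subgroup, so a nontrivial character already
    differs from 1 there. *)
Definition pint_one : padic_int p := MkPadicInt pint_one_subproof.

Lemma chi_neq1 xi : xi != 0 -> chi R xi pint_one != 1.
Proof.
move=> xi0; apply/eqP; rewrite (@chiE _ _ (dexp xi)) // expi_modz ?dexp_le //.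
rewrite mulr1 => /expi_eq1; rewrite Qint_def => /eqP d1.
suff : dexp xi == 0%N by rewrite dexp_eq0 (negPf xi0).
by rewrite /dexp d1 logn1.
Qed.

Fact level_dual_subproof n (j : 'I_(p ^ n)) : pdual_pred p (j%:R / (p ^ n)%:R).
Proof.
apply/andP; split.
  by apply/asboolP; exists n; rewrite mulrC divfK // natr_int.
rewrite divr_ge0 ?ler0n //= ltr_pdivrMr ?mul1r ?ltr_nat //.
by rewrite ltr0n expn_gt0 p0.
Qed.
Definition level_dual n (j : 'I_(p ^ n)) : pdual p :=
  MkDual (level_dual_subproof j).

(** The classes j / p^n form the annihilator of p^n Z_p; the sum of its characters is a multiple of
    the indicator of that subgroup, by orthogonality of roots of unity. *)
Lemma sum_chi_level n x : \sum_(j < p ^ n) chi R (level_dual j) x =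
  if x n == 0 then (p ^ n)%:R else 0.
Proof.
rewrite -[x n == 0](_ : ((p ^ n)%N%:Z %| x n)%Z = _); last first.
  apply/idP/eqP => [/dvdz_mod0P|->]; last exact: dvdz0.
  by rewrite res_modK.
rewrite -(sum_expi R) ?expn_gt0 ?p0 //; apply: eq_bigr => j _.
pose m := maxn n (dexp (level_dual j)).
rewrite (@chiE _ _ m) ?leq_max ?leqnn ?orbT //=.
rewrite -[RHS](_ : expi R (j%:R / (p ^ n)%:R * (x m)%:~R) = _) //.
rewrite -(@expi_modz _ _ n); last by rewrite mulrC divfK // natr_int.
by rewrite -res_mod_le // leq_max leqnn.
Qed.

(** The map sending [xi] to [p ^ n * dval xi] is injective, with values among the integers from 0 to
    [p ^ n - 1]. *)
Lemma level_count n (s : seq (pdual p)) : uniq s ->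
  {in s, forall xi, dexp xi <= n}%N -> (size s <= p ^ n)%N.
Proof.
move=> us sn.
pose f xi := `|numq ((p ^ n)%:R * dval xi)|%N.
have fE xi : (dexp xi <= n)%N -> (f xi)%:R = (p ^ n)%:R * dval xi.
  move=> /dexp_le/intrP[a ka].
  have a0 : 0 <= a.
    by rewrite -(ler0z rat) -ka mulr_ge0 ?ler0n //; case/andP: (dval_itv xi).
  by rewrite /f ka numq_int pmulrn gez0_abs.
rewrite -(size_map f) -[X in (_ <= X)%N](size_iota 0); apply: uniq_leq_size.
  rewrite map_inj_in_uniq // => xi eta /sn xin /sn etan.
  move/(congr1 (fun k => k%:R : rat)); rewrite !fE // => /(mulfI (pX0 n)).
  exact: val_inj.
move=> _ /mapP[xi /sn xin ->]; rewrite mem_iota /= add0n -(ltr_nat rat) fE //.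
rewrite -[ltRHS]mulr1 ltr_pM2l; first by case/andP: (dval_itv xi).
by rewrite ltr0n expn_gt0 p0.
Qed.

(* At most [p ^ n] characters have bracket [p ^ n], so the sum is dominated by
   the geometric series of ratio [p^-1 <= 1 / 2]. *)
Lemma sum_bracket (s : seq (pdual p)) : uniq s ->
  \sum_(xi <- s) (bracket R xi) ^- 2 <= 2.
Proof.
move=> us; pose N := (\max_(xi <- s) dexp xi).+1.
have le_N xi : xi \in s -> (dexp xi < N)%N by move=> ?; rewrite ltnS leq_bigmax_seq.
have q0 n : 0 <= (p ^ n)%:R ^- 2 :> R by rewrite invr_ge0 exprn_ge0.
apply: (@le_trans _ _ (\sum_(xi <- s) \sum_(n < N | dexp xi == n) (p ^ n)%:R ^- 2)).
  rewrite big_seq [leRHS]big_seq; apply: ler_sum => xi xis.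
  rewrite (bigD1 (Ordinal (le_N _ xis))) //= bracketE lerDl.
  by apply: sumr_ge0.
rewrite (exchange_big_dep predT) /=; last by [].
apply: (@le_trans _ _ (\sum_(n < N) 2^-1 ^+ n)).
  apply: ler_sum => n _; rewrite -big_filter big_const_seq count_predT iter_addr addr0.
  have sz : (size [seq xi <- s | dexp xi == n] <= p ^ n)%N.
    apply: level_count; first exact: filter_uniq.
    by move=> xi; rewrite mem_filter => /andP[/eqP ->].
  have pn0 : 0 < (p ^ n)%:R :> R by rewrite ltr0n expn_gt0 p0.
  apply: (@le_trans _ _ ((p ^ n)%:R ^-1)).
    rewrite -[X in X <= _]mulr_natr ler_pdivrMl; last first.
      by rewrite exprn_gt0.
    rewrite expr2 -mulrA divff ?gt_eqF // mulr1 ler_nat.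
    exact: sz.
  rewrite natrX -exprVn lerXn2r ?nnegrE ?invr_ge0 //.
  by rewrite lef_pV2 ?posrE ?ltr0n // ler_nat prime_gt1.
have := subrX1 (2^-1 : R) N; have : 0 <= 2^-1 ^+ N :> R by rewrite exprn_ge0.
set a := _ ^+ N; set b := \sum_(_ < _) _ => a0.
rewrite (_ : 2^-1 - 1 = - 2^-1 :> R); last by field.
move=> ab; have -> : b = 2 - 2 * a.
  rewrite -[b](mulVKf (_ : 2 != 0 :> R)) // -[2^-1 * b]opprK -mulNr -ab.
  by ring.
by lra.
Qed.

End Duals.

(** * Modulus, real part and imaginary part of complex numbers *)

Section ComplexModulus.
Variable R : realType.
Implicit Types z w : R[i].

Lemma cmod_ge0 z : 0 <= cmod z.
Proof. by case: z => a b; exact: sqrtr_ge0. Qed.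

Lemma normr_Re_le z : `|complex.Re z| <= cmod z.
Proof.
case: z => a b; rewrite /cmod /= -sqrtr_sqr ler_sqrt ?addr_ge0 ?sqr_ge0 //.
by rewrite lerDl sqr_ge0.
Qed.

Lemma normr_Im_le z : `|complex.Im z| <= cmod z.
Proof.
case: z => a b; rewrite /cmod /= -sqrtr_sqr ler_sqrt ?addr_ge0 ?sqr_ge0 //.
by rewrite lerDr sqr_ge0.
Qed.

Lemma cmod_le_ReIm z : cmod z <= `|complex.Re z| + `|complex.Im z|.
Proof.
case: z => a b; rewrite /cmod /=.
rewrite -[leRHS]ger0_norm ?addr_ge0 // -sqrtr_sqr ler_sqrt ?sqr_ge0 //.
rewrite sqrrD !real_normK ?num_real // lerD2r lerDl mulrn_wge0 //.
Qed.

Lemma cmodM z w : cmod (z * w) = cmod z * cmod w.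
Proof. exact: ComplexField.Normc.normcM. Qed.

Lemma cmodD z w : cmod (z + w) <= cmod z + cmod w.
Proof. exact: le_normcD. Qed.

Lemma cmodN z : cmod (- z) = cmod z.
Proof. exact: normcN. Qed.

Lemma cmod0 : cmod (0 : R[i]) = 0.
Proof. exact: ComplexField.Normc.normc0. Qed.

Lemma cmod_real (a : R) : cmod (a%:C)%C = `|a|.
Proof. by rewrite /cmod /= expr0n addr0 sqrtr_sqr. Qed.

Lemma ReM z w : complex.Re (z * w) =
  complex.Re z * complex.Re w - complex.Im z * complex.Im w.
Proof. by case: z w => [a b] [c d]. Qed.

Lemma ImM z w : complex.Im (z * w) =
  complex.Re z * complex.Im w + complex.Im z * complex.Re w.
Proof. by case: z w => [a b] [c d]. Qed.

Lemma ReD z w : complex.Re (z + w) = complex.Re z + complex.Re w.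
Proof. by case: z w => [a b] [c d]. Qed.

Lemma ImD z w : complex.Im (z + w) = complex.Im z + complex.Im w.
Proof. by case: z w => [a b] [c d]. Qed.

Lemma ReIm_eq z w : complex.Re z = complex.Re w ->
  complex.Im z = complex.Im w -> z = w.
Proof. by case: z w => [a b] [c d] /= -> ->. Qed.

End ComplexModulus.

(** * Measurability of complex functions *)

Section ComplexMeasurable.
Context d (X : measurableType d) (R : realType).
Implicit Types f g : X -> R[i].

Lemma cmeasurable_cst z : cmeasurable (fun _ : X => z : R[i]).
Proof. by split; exact: measurable_cst. Qed.

Lemma cmeasurableM f g : cmeasurable f -> cmeasurable g ->
  cmeasurable (fun x => f x * g x).
Proof.
move=> [f1 f2] [g1 g2]; split.
  under eq_fun do rewrite ReM.
  by apply: measurable_funB; apply: measurable_funM.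
under eq_fun do rewrite ImM.
by apply: measurable_funD; apply: measurable_funM.
Qed.

Lemma cmeasurableD f g : cmeasurable f -> cmeasurable g ->
  cmeasurable (fun x => f x + g x).
Proof.
move=> [f1 f2] [g1 g2]; split.
  by under eq_fun do rewrite ReD; exact: measurable_funD.
by under eq_fun do rewrite ImD; exact: measurable_funD.
Qed.

Lemma cmeasurable_sum (I : Type) (s : seq I) (F : I -> X -> R[i]) :
  (forall i, cmeasurable (F i)) -> cmeasurable (fun x => \sum_(i <- s) F i x).
Proof.
move=> mF; elim: s => [|i s IHs].
  by under eq_fun do rewrite big_nil; exact: cmeasurable_cst.
by under eq_fun do rewrite big_cons; exact: cmeasurableD.
Qed.

Lemma measurable_cmod f : cmeasurable f ->
  measurable_fun [set: X] (fun x => cmod (f x)).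
Proof.
move=> [f1 f2].
rewrite (_ : (fun x => cmod (f x)) =
  (fun x => Num.sqrt (complex.Re (f x) ^+ 2 + complex.Im (f x) ^+ 2))).
  apply: (measurableT_comp (continuous_measurable_fun (@sqrt_continuous R))).
  by apply: measurable_funD; exact: measurable_funX.
by apply/funext => x; rewrite /cmod; case: (f x).
Qed.

End ComplexMeasurable.

(** * Integration of complex functions against a probability *)

Section ComplexIntegral.
Variables (R : realType) (p : nat) (mu : probability (padic_int p) R).
Implicit Types (f g : padic_int p -> R[i]).

Definition cintegrable f : Prop :=
  mu.-integrable setT (EFin \o (fun x => complex.Re (f x))) /\
  mu.-integrable setT (EFin \o (fun x => complex.Im (f x))).

Lemma cintegrable_measurable f : cintegrable f -> cmeasurable f.
Proof.
by move=> [f1 f2]; split; apply/measurable_EFinP;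
  [exact: measurable_int f1|exact: measurable_int f2].
Qed.

Lemma cintegrable_dominated f (h : padic_int p -> R) :
    cmeasurable f -> mu.-integrable setT (EFin \o h) ->
  (forall x, cmod (f x) <= h x) -> cintegrable f.
Proof.
move=> [f1 f2] hi fh; split; apply: le_integrable hi => //.
- exact/measurable_EFinP.
- move=> x _ /=; rewrite lee_fin (le_trans (normr_Re_le _)) //.
  by rewrite (le_trans (fh x)) // ler_norm.
- exact/measurable_EFinP.
- move=> x _ /=; rewrite lee_fin (le_trans (normr_Im_le _)) //.
  by rewrite (le_trans (fh x)) // ler_norm.
Qed.

Lemma integrable_cmod f : cintegrable f ->
  mu.-integrable setT (EFin \o (fun x => cmod (f x))).
Proof.
move=> fi; have fm := cintegrable_measurable fi; case: fi => f1 f2.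
apply: (@le_integrable _ _ _ mu _ measurableT _ (EFin \o
  (fun x => `|complex.Re (f x)| + `|complex.Im (f x)|))).
- by apply/measurable_EFinP; exact: measurable_cmod.
- move=> x _ /=; rewrite lee_fin ger0_norm ?cmod_ge0 // ger0_norm ?addr_ge0 //.
  exact: cmod_le_ReIm.
- have := integrableD measurableT (integrable_norm f1) (integrable_norm f2).
  by apply: eq_integrable.
Qed.

Lemma integrable_cst_prob (C : R) : mu.-integrable setT (EFin \o cst C).
Proof. exact: finite_measure_integrable_cst. Qed.

Lemma cintegrable_bounded f (C : R) : cmeasurable f ->
  (forall x, cmod (f x) <= C) -> cintegrable f.
Proof.
by move=> fm; apply: cintegrable_dominated fm (integrable_cst_prob C).
Qed.

Lemma L2_bounded f (C : R) : cmeasurable f ->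
  (forall x, cmod (f x) <= C) -> L2 mu f.
Proof.
move=> fm fC; split=> //.
have fi : mu.-integrable setT (EFin \o (fun x => cmod (f x) ^+ 2)).
  apply: (@le_integrable _ _ _ mu _ measurableT _ (EFin \o cst (C ^+ 2))).
  - by apply/measurable_EFinP; apply: measurable_funX; exact: measurable_cmod.
  - move=> x _ /=; rewrite lee_fin !ger0_norm ?sqr_ge0 //.
    by rewrite lerXn2r ?nnegrE ?cmod_ge0 // (le_trans _ (fC x)) ?cmod_ge0.
  - exact: integrable_cst_prob.
case/integrableP: fi => _; under eq_integral => x _ do
  rewrite /= ger0_norm ?sqr_ge0 //.
by [].
Qed.

Lemma L2_cintegrable f : L2 mu f -> cintegrable f.
Proof.
move=> [fm f2]; apply: (@cintegrable_dominated _ (fun x => 1 + cmod (f x) ^+ 2)) => //.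
  have i2 : mu.-integrable setT (EFin \o (fun x => cmod (f x) ^+ 2)).
    apply/integrableP; split.
      by apply/measurable_EFinP; apply: measurable_funX; exact: measurable_cmod.
    by under eq_integral => x _ do rewrite /= ger0_norm ?sqr_ge0 //.
  have := integrableD measurableT (integrable_cst_prob 1) i2.
  by apply: eq_integrable.
(* Expanding (c - 1/2)^2 >= 0 gives c <= c^2 + 1/4, so [1 + cmod (f x) ^+ 2] dominates, and it is
   integrable because the total mass is finite. *)
move=> x; have := sqr_ge0 (cmod (f x) - 2^-1).
set c := cmod _; rewrite sqrrB => ?; nra.
Qed.

Lemma fine_mu_setT : fine (mu setT) = 1 :> R.
Proof. exact: congr1 (probability_setT mu). Qed.

Lemma cintegrableM f g : cintegrable f -> cmeasurable g ->
  (forall x, cmod (g x) <= 1) -> cintegrable (fun x => f x * g x).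
Proof.
move=> fi gm g1; apply: (cintegrable_dominated _ (integrable_cmod fi)).
  by apply: cmeasurableM => //; exact: cintegrable_measurable.
by move=> x; rewrite cmodM ler_piMr ?cmod_ge0.
Qed.

Lemma cintegrableD f g : cintegrable f -> cintegrable g ->
  cintegrable (fun x => f x + g x).
Proof.
move=> fi gi; apply: (@cintegrable_dominated _ (fun x => cmod (f x) + cmod (g x))).
- by apply: cmeasurableD; exact: cintegrable_measurable.
- have := integrableD measurableT (integrable_cmod fi) (integrable_cmod gi).
  by apply: eq_integrable.
- by move=> x; exact: cmodD.
Qed.

Lemma cintegrableZ (a : R[i]) f : cintegrable f -> cintegrable (fun x => a * f x).
Proof.
move=> fi; apply: (@cintegrable_dominated _ (fun x => cmod a * cmod (f x))).
- apply: cmeasurableM; first exact: cmeasurable_cst.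
  exact: cintegrable_measurable.
- have := integrableZl measurableT (cmod a) (integrable_cmod fi).
  by apply: eq_integrable.
- by move=> x; rewrite cmodM.
Qed.

Lemma cintegrable0 : cintegrable (fun=> 0).
Proof.
apply: (@cintegrable_bounded _ 0); first exact: cmeasurable_cst.
by move=> x; rewrite cmod0.
Qed.

Lemma cintegrable_sum (I : Type) (s : seq I) (F : I -> padic_int p -> R[i]) :
  (forall i, cintegrable (F i)) -> cintegrable (fun x => \sum_(i <- s) F i x).
Proof.
move=> mF; elim: s => [|i s IHs].
  by under eq_fun do rewrite big_nil; exact: cintegrable0.
by under eq_fun do rewrite big_cons; exact: cintegrableD.
Qed.

Lemma cintegralD f g : cintegrable f -> cintegrable g ->
  cintegral mu (fun x => f x + g x) = cintegral mu f + cintegral mu g.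
Proof.
move=> [f1 f2] [g1 g2]; apply: ReIm_eq => /=.
  by under eq_Rintegral do rewrite ReD; rewrite RintegralD // ReD.
by under eq_Rintegral do rewrite ImD; rewrite RintegralD // ImD.
Qed.

Lemma cintegralZ (a : R[i]) f : cintegrable f ->
  cintegral mu (fun x => a * f x) = a * cintegral mu f.
Proof.
move=> [f1 f2]; have Z c h (hi : mu.-integrable setT (EFin \o h)) :
    mu.-integrable setT (EFin \o (fun x => c * h x)).
  by have := integrableZl measurableT c hi; apply: eq_integrable.
apply: ReIm_eq => /=.
  under eq_Rintegral do rewrite ReM.
  by rewrite RintegralB ?RintegralZl ?ReM //; exact: Z.
under eq_Rintegral do rewrite ImM.
by rewrite RintegralD ?RintegralZl ?ImM //; exact: Z.
Qed.

Lemma cintegral_cst (a : R[i]) : cintegral mu (fun=> a) = a.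
Proof.
by apply: ReIm_eq => /=; rewrite Rintegral_cst // [X in _ * X]fine_mu_setT mulr1.
Qed.

Lemma cintegral_sum (I : Type) (s : seq I) (F : I -> padic_int p -> R[i]) :
  (forall i, cintegrable (F i)) ->
  cintegral mu (fun x => \sum_(i <- s) F i x) = \sum_(i <- s) cintegral mu (F i).
Proof.
move=> mF; elim: s => [|i s IHs].
  by under eq_fun do rewrite big_nil; rewrite big_nil cintegral_cst.
under eq_fun do rewrite big_cons; rewrite big_cons cintegralD ?IHs //.
exact: cintegrable_sum.
Qed.

Lemma cintegral_ae f g : cmeasurable f -> cmeasurable g -> ae_equal mu f g ->
  cintegral mu f = cintegral mu g.
Proof.
move=> [f1 f2] [g1 g2] fg; apply: ReIm_eq => /=; congr fine;
  (apply: ae_eq_integral => //; [exact/measurable_EFinP|exact/measurable_EFinP|]);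
  by apply: filterS fg => x /= fgx _; rewrite fgx.
Qed.

(** Real and imaginary parts are bounded by [C] separately. This is the source of the doubled
    constants in [fourier_bound] and [fourier_decay]. *)
Lemma cmod_cintegral_le f (C : R) : cmeasurable f ->
  (forall x, cmod (f x) <= C) -> cmod (cintegral mu f) <= C + C.
Proof.
move=> fm fC; have [f1 f2] := cintegrable_bounded fm fC.
have bnd h : mu.-integrable setT (EFin \o h) -> (forall x, `|h x| <= C) ->
    `|Rintegral mu setT h| <= C.
  move=> hi hC; apply: (le_trans (le_normr_Rintegral measurableT hi)).
  rewrite -[leRHS]mulr1 -[X in _ <= _ * X]fine_mu_setT.
  rewrite -Rintegral_cst //; apply: le_Rintegral => //.
    by have := integrable_norm hi; apply: eq_integrable.
  exact: integrable_cst_prob.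
apply: (le_trans (cmod_le_ReIm _)); apply: lerD => /=; apply: bnd => // x.
  exact: le_trans (normr_Re_le _) (fC x).
exact: le_trans (normr_Im_le _) (fC x).
Qed.

(** Dominated convergence for integrals that are eventually constant: the Fourier coefficient at
    [xi] of a partial sum no longer changes once [xi] has been enumerated. *)
Lemma cintegral_dominated (F : nat -> padic_int p -> R[i]) f (C : R) (z : R[i]) :
    (forall n, cmeasurable (F n)) -> (forall n x, cmod (F n x) <= C) ->
    (forall x, (fun n => complex.Re (F n x)) @ \oo --> complex.Re (f x)) ->
    (forall x, (fun n => complex.Im (F n x)) @ \oo --> complex.Im (f x)) ->
    (\forall n \near \oo, cintegral mu (F n) = z) ->
  cintegral mu f = z.
Proof.
move=> mF FC cRe cIm [N _ Nz].
have key (h : nat -> padic_int p -> R) (g : padic_int p -> R) c :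
    (forall n, measurable_fun setT (h n)) -> (forall n x, `|h n x| <= C) ->
    (forall x, h ^~ x @ \oo --> g x) ->
    (forall n, (N <= n)%N -> Rintegral mu setT (h n) = c) ->
    Rintegral mu setT g = c.
  move=> mh hC hg hc.
  have mg : measurable_fun setT g.
    by apply: (measurable_fun_cvg mh) => x _; exact: hg.
  have [] := @dominated_convergence _ _ _ mu _ measurableT
    (fun n => EFin \o h n) (EFin \o g) (EFin \o cst C).
  - by move=> n; exact/measurable_EFinP.
  - exact/measurable_EFinP.
  - by apply: aeW => x _; apply: cvg_EFin; [exact: nearW|exact: hg].
  - exact: integrable_cst_prob.
  - by apply: aeW => x n _ /=; rewrite lee_fin.
  move=> gi _ cv.
  have cst_cv : (fun n => \int[mu]_x (h n x)%:E)%E @ \oo --> c%:E.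
    apply: cvg_near_cst; exists N => // n /= Nn; rewrite -(hc n Nn).
    rewrite /Rintegral fineK //; apply: integrable_fin_num => //.
    apply: (@le_integrable _ _ _ mu _ measurableT _ (EFin \o cst C)).
    - exact/measurable_EFinP.
    - by move=> x _ /=; rewrite lee_fin (le_trans (hC n x)) // ler_norm.
    - exact: integrable_cst_prob.
  rewrite /Rintegral.
  exact: congr1 (cvg_unique (@ereal_hausdorff R) cv cst_cv).
apply: ReIm_eq => /=.
- apply: (key (fun n x => complex.Re (F n x))).
  + by move=> n; case: (mF n).
  + by move=> n x; exact: le_trans (normr_Re_le _) (FC n x).
  + exact: cRe.
  + by move=> n Nn; rewrite -(Nz n Nn).
- apply: (key (fun n x => complex.Im (F n x))).
  + by move=> n; case: (mF n).
  + by move=> n x; exact: le_trans (normr_Im_le _) (FC n x).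
  + exact: cIm.
  + by move=> n Nn; rewrite -(Nz n Nn).
Qed.

End ComplexIntegral.

(** * Measurability of sets and maps that depend on one residue *)

Section Balls.
Variable p : nat.

Lemma measurable_ball (n : nat) (c : int) :
  measurable [set x : padic_int p | x n = c].
Proof.
(* Generators are balls around points; if [c] is the residue of no point, the set is empty. *)
have [[a an]|na] := pselect (exists a : padic_int p, a n = c).
  apply: sub_sigma_algebra; exists (a, n) => //=.
  by rewrite an.
rewrite (_ : [set _ | _] = set0) //.
by apply/seteqP; split=> // x xn; apply: na; exists x.
Qed.

Lemma measurable_level_set (n : nat) (A : set int) :
  measurable [set x : padic_int p | A (x n)].
Proof.
rewrite [X in measurable X](_ : _ = \bigcup_c
    (if c \in A then [set x : padic_int p | x n = c] else set0)).
  apply: countable_bigcupT_measurable => // c.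
  by case: ifP => // _; exact: measurable_ball.
apply/seteqP; split=> [x Ax|x [c _]].
  by exists (x n) => //; rewrite mem_set.
by case: ifPn => //; rewrite inE => Ac /= xc; rewrite /= xc.
Qed.

Lemma measurable_level d (Y : measurableType d) (n : nat) (F : int -> Y) :
  measurable_fun [set: padic_int p] (fun x => F (x n)).
Proof. by move=> _ B _; rewrite setTI; exact: (@measurable_level_set n (F @^-1` B)). Qed.

(** It suffices to test the generating balls, and whether [a + x] lies in a ball of level [n]
    depends only on the residue [x n]. *)
Lemma measurable_translation (a : padic_int p) :
  measurable_fun [set: padic_int p] (fun x => a + x).
Proof.
apply: (@measurability _ _ _ _ _ _ (@pint_balls p)) => // _ [_ [[b n] _ <-] <-].
rewrite setTI.
exact: (@measurable_level_set n [set c | ((a n + c) %% (p ^ n)%N)%Z = b n]).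
Qed.

End Balls.

(** * Orthogonality of characters and uniqueness of Fourier coefficients *)

Section Fourier.
Variables (R : realType) (p : nat).
Hypothesis p_prime : prime p.
Variable mu : probability (padic_int p) R.
Hypothesis mu_haar : is_haar mu.
Implicit Types (f g : padic_int p -> R[i]) (xi eta : pdual p).

Lemma cmeasurable_chi xi : cmeasurable (chi R xi).
Proof.
pose F (c : int) := expi R (dval xi * c%:~R).
rewrite (_ : chi R xi = (fun x => F (x (dexp xi)))); last first.
  by apply/funext => x; rewrite (@chiE _ _ p_prime _ _ (dexp xi)).
split; first exact: (@measurable_level _ _ _ _ (fun c => complex.Re (F c))).
exact: (@measurable_level _ _ _ _ (fun c => complex.Im (F c))).
Qed.

Lemma cintegrable_chi xi : cintegrable mu (chi R xi).
Proof.
apply: (@cintegrable_bounded _ _ _ _ 1); first exact: cmeasurable_chi.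
by move=> x; rewrite cmod_chi.
Qed.

Lemma cintegrable_mul_chi f xi : cintegrable mu f ->
  cintegrable mu (fun x => f x * chi R xi x).
Proof.
move=> fi; apply: cintegrableM => //; first exact: cmeasurable_chi.
by move=> x; rewrite cmod_chi.
Qed.

Lemma cintegrable_fourier f xi : cintegrable mu f ->
  cintegrable mu (fun x => f x * (chi R xi x)^*).
Proof.
by move=> fi; under eq_fun do rewrite -chiN //; exact: cintegrable_mul_chi.
Qed.

Lemma cintegral_translation f a : cmeasurable f -> (forall x, cmod (f x) <= 1) ->
  cintegral mu (fun x => f (a + x)) = cintegral mu f.
Proof.
move=> mf f1.
have key (h : padic_int p -> R) : measurable_fun setT h -> (forall x, `|h x| <= 1) ->
    Rintegral mu setT (fun x => h (a + x)) = Rintegral mu setT h.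
  move=> mh h1; congr fine.
  have hi : mu.-integrable setT (EFin \o h \o (fun x => a + x)).
    apply: (@le_integrable _ _ _ mu _ measurableT _ (EFin \o cst 1)).
    - apply/measurable_EFinP.
      exact: (measurableT_comp mh (measurable_translation a)).
    - by move=> x _ /=; rewrite lee_fin normr1.
    - exact: integrable_cst_prob.
  have mEh : measurable_fun setT (EFin \o h) by exact/measurable_EFinP.
  have := integral_pushforward (measurable_translation a) mEh hi measurableT.
  move=> E; rewrite -[LHS]E; apply: eq_measure_integral.
    exact: measurable_translation.
  move=> mt A mA _.
  (* The preimage of [A] under translation by [a] is its image under translation by [- a], so
     invariance is used at [- a]. *)
  rewrite -[RHS](mu_haar (- a) mA) /pushforward; congr (mu _).
  apply/seteqP; split=> [x Ax|x [y Ay <-]] /=.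
    by exists (a + x) => //; rewrite addKr.
  by rewrite addNKr.
case: mf => f_1 f_2; apply: ReIm_eq => /=.
  apply: (key (fun x => complex.Re (f x))) => // x.
  exact: le_trans (normr_Re_le _) (f1 x).
apply: (key (fun x => complex.Im (f x))) => // x.
exact: le_trans (normr_Im_le _) (f1 x).
Qed.

(** Translating by [pint_one] multiplies the integral by the value of the character there, which is
    not 1 when [xi != 0]; the integral is then 0. *)
Lemma cintegral_chi xi : cintegral mu (chi R xi) = (xi == 0)%:R.
Proof.
have [->|xi0] := eqVneq xi 0.
  rewrite (_ : chi R 0 = (fun=> 1)) ?cintegral_cst //.
  by apply/funext => x; rewrite chi0.
have := @cintegral_translation (chi R xi) (pint_one p) (cmeasurable_chi xi).
move=> /(_ (fun x => ltac:(by rewrite cmod_chi))).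
under eq_fun do rewrite chiDr //.
rewrite cintegralZ; last exact: cintegrable_chi.
move=> /eqP; rewrite -subr_eq0 -[X in _ - X]mul1r -mulrBl mulf_eq0 subr_eq0.
by rewrite (negPf (chi_neq1 R p_prime xi0)) /= => /eqP.
Qed.

Lemma fourier_chi xi eta : fourier mu (chi R xi) eta = (xi == eta)%:R.
Proof.
rewrite /fourier; under eq_fun do rewrite -chiN // -chiDl //.
by rewrite -subr_eq0 -cintegral_chi; congr cintegral.
Qed.

Lemma fourierD f g xi : cintegrable mu f -> cintegrable mu g ->
  fourier mu (fun x => f x + g x) xi = fourier mu f xi + fourier mu g xi.
Proof.
move=> fi gi; rewrite /fourier -cintegralD; [|exact: cintegrable_fourier..].
by under eq_fun do rewrite mulrDl.
Qed.

Lemma fourierZ (a : R[i]) f xi : cintegrable mu f ->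
  fourier mu (fun x => a * f x) xi = a * fourier mu f xi.
Proof.
move=> fi; rewrite /fourier -cintegralZ; last exact: cintegrable_fourier.
by under eq_fun do rewrite -mulrA.
Qed.

Lemma fourier_sum (I : Type) (s : seq I) (F : I -> padic_int p -> R[i]) xi :
    (forall i, cintegrable mu (F i)) ->
  fourier mu (fun x => \sum_(i <- s) F i x) xi = \sum_(i <- s) fourier mu (F i) xi.
Proof.
move=> Fi; rewrite /fourier -cintegral_sum; last first.
  by move=> i; exact: cintegrable_fourier.
by under eq_fun do rewrite mulr_suml.
Qed.

(* Balls and the empty set form a pi-system that generates the sigma-algebra,
   so Dynkin's theorem extends the vanishing to all measurable sets. *)
Lemma integral_ball_eq0 (h : padic_int p -> R) :
    mu.-integrable setT (EFin \o h) ->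
    (forall (a : padic_int p) n,
      \int[mu]_(x in [set x : padic_int p | x n = a n]) (h x)%:E = 0)%E ->
  {ae mu, forall x, h x = 0}.
Proof.
move=> hi h0; pose G := @pint_balls p `|` [set set0].
have GE : @measurable _ (padic_int p) = <<s G >>.
  apply/seteqP; split; last first.
  - apply: smallest_sub; first exact: sigma_algebra_measurable.
    move=> A [GA|->]; first exact: sub_sigma_algebra.
    exact: (@measurable0 _ (padic_int p)).
  apply: smallest_sub; first exact: smallest_sigma_algebra.
  by move=> A GA; apply: sub_sigma_algebra; left.
have GI : setI_closed G.
  move=> _ _ [[[a n] _ <-]|->] [[[b m] _ <-]|->]; rewrite ?set0I ?setI0;
    try by right.
  (* Two balls are nested or disjoint: the finer one lies in the coarser or misses it, according to
     the residue of its centre at the coarser level. *)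
  wlog nm : a b n m / (n <= m)%N => [H|].
    by have /orP[|] := leq_total n m => /H; [exact|rewrite setIC; exact].
  have [ab|ab] := pselect (b n = a n); [left|right].
    exists (b, m) => //; apply/seteqP; split=> x /=; last by case.
    move=> xm; split=> //.
    by rewrite (res_mod_le x nm) xm -res_mod_le.
  apply/seteqP; split=> // x /= [xn xm]; apply: ab.
  by rewrite (res_mod_le b nm) -xm -res_mod_le.
have mS A : measurable A -> mu.-integrable A (EFin \o h).
  by move=> mA; apply: integrableS hi.
suff H A : measurable A -> (\int[mu]_(x in A) (h x)%:E = 0)%E.
  have : ae_eq mu setT (EFin \o h) (cst 0%E).
    apply: integral_ae_eq => // E _ mE.
    by rewrite integral_cst // mul0e; exact: H.
  by apply: filterS => x /= /(_ I) [].
(* At level 0 residues are taken modulo 1, so the whole space is itself a ball and its integral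
   vanishes; the case of complements relies on this too. *)
have hT : setT = [set x : padic_int p | x 0%N = (0 : padic_int p) 0%N].
  by apply/seteqP; split=> // x _ /=; rewrite -(res_modK x) modz1.
rewrite GE; move: A; apply: (@dynkin_induction _ (padic_int p) G
  (fun A => \int[mu]_(x in A) (h x)%:E = 0)%E GE GI).
- by rewrite hT.
- move=> _ [[[a n] _ <-]|->]; first exact: h0.
  by rewrite integral_set0.
- move=> A mA A0.
  have := h0 0 0%N; rewrite -hT -(setUv A) integral_setU //.
  + by rewrite A0 add0e.
  + exact: measurableC.
  + by rewrite setUv; exact: measurable_int hi.
  + by apply/disj_setPCl.
- move=> F mF tF F0.
  have mU : measurable (\bigcup_k F k) by exact: bigcupT_measurable.
  rewrite integral_bigcup //; last exact: mS.
  by apply: eseries0 => i _ _; exact: F0.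
Qed.

Lemma fourier_eq0 f : cintegrable mu f -> (forall xi, fourier mu f xi = 0) ->
  ae_equal mu f (fun=> 0).
Proof.
move=> fi f0.
pose restr (a : padic_int p) n (x : padic_int p) := if x n == a n then f x else 0.
have ball0 a n : cintegral mu (restr a n) = 0.
  have pn0 : (p ^ n)%:R != 0 :> R[i].
    by rewrite pnatr_eq0 -lt0n expn_gt0 prime_gt0.
  (* With these weights the sum over [j] of [c j] times the conjugate of the [j]-th character at [x]
     is [p ^- n] times the sum of the characters at [a - x], that is, the indicator of the ball of
     level [n] around [a]. *)
  pose c (j : 'I_(p ^ n)) := (p ^ n)%:R^-1 * chi R (level_dual p_prime j) a.
  rewrite (_ : restr a n = (fun x => \sum_(j < p ^ n)
      c j * (f x * (chi R (level_dual p_prime j) x)^*))).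
    rewrite cintegral_sum; last first.
      by move=> j; apply: cintegrableZ; exact: cintegrable_fourier.
    apply: big1 => j _; rewrite cintegralZ; last exact: cintegrable_fourier.
    by rewrite -/(fourier mu f _) f0 mulr0.
  apply/funext => x; rewrite /restr -res_subr_eq0.
  under eq_bigr => j _ do
    rewrite /c mulrCA -mulrA -chi_oppr // -chiDr // mulrA.
  rewrite -mulr_sumr sum_chi_level //.
  by case: ifP; rewrite ?mulr0 // -mulrA mulVf ?mulr1.
have [f1 f2] := fi.
have part (P : R[i] -> R) : P 0 = 0 ->
    mu.-integrable setT (EFin \o (fun x => P (f x))) ->
    (forall a n, Rintegral mu setT (fun x => P (restr a n x)) = 0) ->
    {ae mu, forall x, P (f x) = 0}.
  move=> P0 Pi Pr; apply: integral_ball_eq0 => // a n.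
  have mB : measurable [set x : padic_int p | x n = a n].
    exact: measurable_ball.
  rewrite -[LHS]fineK; last first.
    by apply: integrable_fin_num => //; apply: integrableS Pi.
  congr EFin; rewrite -[RHS](Pr a n) -/(Rintegral mu _ _) Rintegral_mkcond.
  congr Rintegral; apply/funext => x; rewrite /patch /restr.
  rewrite (_ : (x \in _) = (x n == a n)) //.
    by case: ifP.
  by apply/idP/eqP; rewrite inE.
have Re0 : {ae mu, forall x, complex.Re (f x) = 0}.
  apply: (part (@complex.Re R)) => // a n.
  by rewrite -[RHS](congr1 (@complex.Re R) (ball0 a n)).
have Im0 : {ae mu, forall x, complex.Im (f x) = 0}.
  apply: (part (@complex.Im R)) => // a n.
  by rewrite -[RHS](congr1 (@complex.Im R) (ball0 a n)).
apply: filterS2 Re0 Im0 => x r0 i0; exact: ReIm_eq.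
Qed.

Lemma fourier_inj f g : cintegrable mu f -> cintegrable mu g ->
  (forall xi, fourier mu f xi = fourier mu g xi) -> ae_equal mu f g.
Proof.
move=> fi gi fg.
have gNi := cintegrableZ (-1) gi.
have : ae_equal mu (fun x => f x + -1 * g x) (fun=> 0).
  apply: fourier_eq0; first exact: cintegrableD.
  by move=> xi; rewrite fourierD // fourierZ // fg mulN1r subrr.
by apply: filterS => x /eqP; rewrite mulN1r subr_eq0 => /eqP.
Qed.

End Fourier.

(** * Absolutely convergent sums over a countable type *)

Section CountableSums.
Variables (R : realType) (T : countType).
Implicit Types (a t : T -> R).

(** The elements of code below [n]: each step adds at most one element, and every element appears
    after finitely many steps. *)
Definition enum_upto n : seq T := pmap (@pickle_inv T) (iota 0 n).

Lemma enum_upto_uniq n : uniq (enum_upto n).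
Proof. exact: (pmap_uniq (@pickle_invK T)) (iota_uniq 0 n). Qed.

Lemma enum_uptoS n : enum_upto n.+1 = enum_upto n ++ seq_of_opt (pickle_inv n).
Proof. by rewrite /enum_upto -addn1 iotaD pmap_cat /= add0n; case: pickle_inv. Qed.

Lemma mem_enum_upto x n : (pickle x < n)%N -> x \in enum_upto n.
Proof.
move=> xn; rewrite mem_pmap; apply/mapP; exists (pickle x).
  by rewrite mem_iota.
by rewrite pickleK_inv.
Qed.

(** Summability is tested on finite families without reference to an enumeration, which makes it
    stable under translating the index in the dual group. *)
Definition sums_le a (C : R) : Prop :=
  forall s : seq T, uniq s -> \sum_(x <- s) a x <= C.

Lemma cvgn_nonneg_sum a C : (forall x, 0 <= a x) -> sums_le a C ->
  cvgn (fun n => \sum_(x <- enum_upto n) a x).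
Proof.
move=> a0 aC; apply: nondecreasing_is_cvgn.
  apply/nondecreasing_seqP => n; rewrite enum_uptoS big_cat /= lerDl.
  by apply: sumr_ge0 => x _.
by exists C => _ [n _ <-]; apply/aC/enum_upto_uniq.
Qed.

(** Writing t as (t + a) - a turns the sum into a difference of two sums of nonnegative terms, each
    with bounded partial sums. *)
Lemma cvgn_dominated_sum t a C : (forall x, `|t x| <= a x) -> sums_le a C ->
  cvgn (fun n => \sum_(x <- enum_upto n) t x).
Proof.
move=> ta aC.
have a0 x : 0 <= a x by rewrite (le_trans _ (ta x)).
have tN x : - a x <= t x by have := ta x; rewrite ler_norml => /andP[].
have tP x : t x <= a x by have := ta x; rewrite ler_norml => /andP[].
have cva := cvgn_nonneg_sum a0 aC.
have cvb : cvgn (fun n => \sum_(x <- enum_upto n) (t x + a x)).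
  apply: (@cvgn_nonneg_sum _ (C + C)) => [x|s us].
    by have := tN x; lra.
  by rewrite big_split lerD ?aC // (le_trans _ (aC s us)) // ler_sum.
rewrite [X in cvgn X](_ : _ = (fun n => \sum_(x <- enum_upto n) (t x + a x)) \-
  (fun n => \sum_(x <- enum_upto n) a x)); first exact: is_cvgB cvb cva.
by apply/funext => n /=; rewrite big_split /= addrK.
Qed.

End CountableSums.

(** * Absolutely convergent Fourier series on Z_p *)

Section FourierSeries.
Variables (R : realType) (p : nat).
Hypothesis p_prime : prime p.
Implicit Types (c : pdual p -> R[i]) (x : padic_int p) (xi : pdual p).

Definition fourier_partial c n x : R[i] :=
  \sum_(xi <- enum_upto (pdual p) n) c xi * chi R xi x.

(** [limn] is total, so this is a function for any [c]; it is the actual sum as soon as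
    [abs_sums_le] holds for [c]. *)
Definition fourier_series c x : R[i] :=
  (limn (fun n => complex.Re (fourier_partial c n x)) +i*
   limn (fun n => complex.Im (fourier_partial c n x)))%C.

Definition abs_sums_le c (C : R) : Prop := sums_le (fun xi => cmod (c xi)) C.

Lemma Re_sum (I : Type) (s : seq I) (F : I -> R[i]) :
  complex.Re (\sum_(i <- s) F i) = \sum_(i <- s) complex.Re (F i).
Proof. by elim/big_rec2: _ => // i a b _ <-; rewrite ReD. Qed.

Lemma Im_sum (I : Type) (s : seq I) (F : I -> R[i]) :
  complex.Im (\sum_(i <- s) F i) = \sum_(i <- s) complex.Im (F i).
Proof. by elim/big_rec2: _ => // i a b _ <-; rewrite ImD. Qed.

Lemma cmod_sum (I : Type) (s : seq I) (F : I -> R[i]) :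
  cmod (\sum_(i <- s) F i) <= \sum_(i <- s) cmod (F i).
Proof.
elim/big_rec2: _ => [|i a b _ ab]; first by rewrite cmod0.
by rewrite (le_trans (cmodD _ _)) // lerD2l.
Qed.

Section Coefficients.
Variables (c : pdual p -> R[i]) (C : R).
Hypothesis cC : abs_sums_le c C.

Lemma cmod_fourier_partial n x : cmod (fourier_partial c n x) <= C.
Proof.
apply: (le_trans (cmod_sum _ _)); apply: le_trans (cC (enum_upto_uniq _ n)).
by apply: ler_sum => xi _; rewrite cmodM cmod_chi // mulr1.
Qed.

Lemma cvg_Re_fourier_partial x :
  (fun n => complex.Re (fourier_partial c n x)) @ \oo -->
  complex.Re (fourier_series c x).
Proof.
rewrite /=.
have -> : (fun n => complex.Re (fourier_partial c n x)) =
  (fun n => \sum_(xi <- enum_upto (pdual p) n) complex.Re (c xi * chi R xi x)).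
  by apply/funext => n; rewrite Re_sum.
apply: (cvgn_dominated_sum _ cC) => xi.
by rewrite (le_trans (normr_Re_le _)) // cmodM cmod_chi // mulr1.
Qed.

Lemma cvg_Im_fourier_partial x :
  (fun n => complex.Im (fourier_partial c n x)) @ \oo -->
  complex.Im (fourier_series c x).
Proof.
rewrite /=.
have -> : (fun n => complex.Im (fourier_partial c n x)) =
  (fun n => \sum_(xi <- enum_upto (pdual p) n) complex.Im (c xi * chi R xi x)).
  by apply/funext => n; rewrite Im_sum.
apply: (cvgn_dominated_sum _ cC) => xi.
by rewrite (le_trans (normr_Im_le _)) // cmodM cmod_chi // mulr1.
Qed.

Lemma cmod_fourier_series x : cmod (fourier_series c x) <= C + C.
Proof.
have bnd (u : nat -> R) (l : R) : u @ \oo --> l -> (forall n, `|u n| <= C) ->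
    `|l| <= C.
  move=> ul uC; have uln : (fun n => `|u n|) @ \oo --> `|l| by exact: cvg_norm.
  rewrite -(cvg_lim (@Rhausdorff R) uln); apply: limr_le; first exact: cvgP uln.
  exact: nearW.
apply: (le_trans (cmod_le_ReIm _)); apply: lerD.
  apply: (bnd _ _ (cvg_Re_fourier_partial (x:=x))) => n.
  exact: le_trans (normr_Re_le _) (cmod_fourier_partial n x).
apply: (bnd _ _ (cvg_Im_fourier_partial (x:=x))) => n.
exact: le_trans (normr_Im_le _) (cmod_fourier_partial n x).
Qed.

Lemma cmeasurable_fourier_partial n : cmeasurable (fourier_partial c n).
Proof.
apply: cmeasurable_sum => xi; apply: cmeasurableM; first exact: cmeasurable_cst.
exact: cmeasurable_chi.
Qed.

Lemma cmeasurable_fourier_series : cmeasurable (fourier_series c).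
Proof.
split.
  apply: (measurable_fun_cvg
    (h := fun n x => complex.Re (fourier_partial c n x))) => [n|x _].
    by case: (cmeasurable_fourier_partial n).
  exact: cvg_Re_fourier_partial.
apply: (measurable_fun_cvg
  (h := fun n x => complex.Im (fourier_partial c n x))) => [n|x _].
  by case: (cmeasurable_fourier_partial n).
exact: cvg_Im_fourier_partial.
Qed.

Lemma fourier_fourier_series (mu : probability (padic_int p) R) xi :
  is_haar mu -> fourier mu (fourier_series c) xi = c xi.
Proof.
move=> mu_haar.
have chiJ (z : R[i]) x : z * (chi R xi x)^* = (chi R xi x)^* * z by rewrite mulrC.
apply: (@cintegral_dominated _ _ mu
    (fun n x => fourier_partial c n x * (chi R xi x)^*) _ C).
- move=> n; apply: cmeasurableM; first exact: cmeasurable_fourier_partial.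
  by under eq_fun do rewrite -chiN //; exact: cmeasurable_chi.
- by move=> n x; rewrite cmodM -chiN // cmod_chi // mulr1 cmod_fourier_partial.
- move=> x; under eq_fun do rewrite ReM; rewrite ReM.
  apply: cvgB; apply: cvgMr_tmp; [exact: cvg_Re_fourier_partial|].
  exact: cvg_Im_fourier_partial.
- move=> x; under eq_fun do rewrite ImM; rewrite ImM.
  apply: cvgD; apply: cvgMr_tmp; [exact: cvg_Re_fourier_partial|].
  exact: cvg_Im_fourier_partial.
(* From this index on the partial sum contains [xi] exactly once, and by orthogonality its
   coefficient at [xi] is [c xi]. *)
exists (pickle xi).+1 => // n /= xin.
rewrite -/(fourier mu _ xi) fourier_sum //; last first.
  by move=> eta; apply: cintegrableZ; exact: cintegrable_chi.
under eq_bigr => eta _ do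
  rewrite (fourierZ p_prime _ _ (cintegrable_chi p_prime mu eta)) fourier_chi //.
rewrite (bigD1_seq xi) ?mem_enum_upto ?enum_upto_uniq //= eqxx mulr1 big1.
  by rewrite addr0.
by move=> eta /negPf ->; rewrite mulr0.
Qed.

End Coefficients.

Lemma fourier_seriesB c1 c2 C1 C2 x : abs_sums_le c1 C1 -> abs_sums_le c2 C2 ->
  fourier_series (fun xi => c1 xi - c2 xi) x =
  fourier_series c1 x - fourier_series c2 x.
Proof.
move=> h1 h2.
have pB n : fourier_partial (fun xi => c1 xi - c2 xi) n x =
    fourier_partial c1 n x + - fourier_partial c2 n x.
  by rewrite -sumrB; apply: eq_bigr => xi _; rewrite mulrBl.
have ReN (z : R[i]) : complex.Re (- z) = - complex.Re z by case: z.
have ImN (z : R[i]) : complex.Im (- z) = - complex.Im z by case: z.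
apply: ReIm_eq; rewrite ?ReD ?ReN ?ImD ?ImN.
  apply/cvg_lim => //; under eq_fun do rewrite pB ReD ReN.
  by apply: cvgB; [exact: (cvg_Re_fourier_partial h1)|exact: (cvg_Re_fourier_partial h2)].
apply/cvg_lim => //; under eq_fun do rewrite pB ImD ImN.
by apply: cvgB; [exact: (cvg_Im_fourier_partial h1)|exact: (cvg_Im_fourier_partial h2)].
Qed.

Lemma abs_sums_leB c1 c2 C1 C2 : abs_sums_le c1 C1 -> abs_sums_le c2 C2 ->
  abs_sums_le (fun xi => c1 xi - c2 xi) (C1 + C2).
Proof.
move=> h1 h2 s us; apply: le_trans (lerD (h1 s us) (h2 s us)).
by rewrite -big_split ler_sum // => xi _; rewrite /= (le_trans (cmodD _ _)) // cmodN.
Qed.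

End FourierSeries.

(** * Schur bounds against decay away from the diagonal *)

Section SchurMatrices.
Variables (R : realType) (p : nat).
Hypothesis p_prime : prime p.
Implicit Types (M : pdual p -> pdual p -> R[i]).

(** Column [xi] of the matrix of an operator lists the Fourier coefficients of the image of
    [chi xi], the data from which the symbol at [xi] is rebuilt; the constant is the same for all
    columns. *)
Lemma schur_column r M : schur_matrix r M ->
  exists C : R, forall xi,
    sums_le (fun eta => cmod (M eta xi) * bracket R (eta - xi) `^ r) C.
Proof.
rewrite /schur_matrix gt_max => /andP[].
set S := ereal_sup _ => Soo _.
have ub xi : (\esum_(eta in [set: pdual p])
    (cmod (M eta xi) * bracket R (eta - xi) `^ r)%:E <= S)%E.
  by apply: ereal_sup_ubound; exists xi.
have t0 xi eta : 0 <= cmod (M eta xi) * bracket R (eta - xi) `^ r.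
  by rewrite mulr_ge0 ?cmod_ge0 ?powR_ge0.
have S0 : (0 <= S)%E.
  by apply: le_trans (ub 0); apply: esum_ge0 => eta _; rewrite lee_fin.
exists (fine S) => xi s us; rewrite -lee_fin fineK ?ge0_fin_numE //.
apply: le_trans (ub xi); apply: esum_ge; exists [set` s].
  by split=> //; exact: finite_seq.
by rewrite -fsbig_seq // sumEFin.
Qed.

Lemma schur_of_decay r M (K : R) : 0 <= r -> 0 <= K ->
    (forall eta xi, cmod (M eta xi) * bracket R (eta - xi) `^ r <=
      K * bracket R (eta - xi) ^- 2) ->
  schur_matrix r M.
Proof.
move=> r0 K0 MK.
(* Rows and columns are treated alike: with one index fixed, the difference of indices is an
   injective function of the other, and [sum_bracket] supplies the factor 2. *)
have bnd (f : pdual p -> pdual p) (a : pdual p -> R) : injective f ->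
    (forall xi, a xi <= K * bracket R (f xi) ^- 2) ->
    (\esum_(xi in [set: pdual p]) (a xi)%:E <= (K * 2)%:E)%E.
  move=> fI aK; apply: ge_ereal_sup => _ [X [finX _] <-].
  rewrite fsbig_finite // sumEFin lee_fin.
  apply: (le_trans (ler_sum _ (fun xi _ => aK xi))).
  rewrite -mulr_sumr ler_wpM2l // -(big_map f xpredT (fun z => bracket R z ^- 2)).
  by apply: sum_bracket => //; rewrite map_inj_uniq // finmap.fset_uniq.
rewrite /schur_matrix gt_max; apply/andP; split;
  apply: (@le_lt_trans _ _ (K * 2)%:E) (ltry _); apply: ge_ereal_sup => _ [xi _ <-].
  by apply: (bnd (fun eta => eta - xi)) => // eta eta' /addIr.
by apply: (bnd (fun eta => xi - eta)) => // eta eta' /addrI/oppr_inj.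
Qed.

End SchurMatrices.

(** * Fourier coefficients and the Vladimirov operators *)

Section Vladimirov.
Variables (R : realType) (p : nat).
Hypothesis p_prime : prime p.
Variable mu : probability (padic_int p) R.
Hypothesis mu_haar : is_haar mu.
Implicit Types (f g : padic_int p -> R[i]) (xi : pdual p) (b : nat).

Definition vladimirov_cst (b : R) : R :=
  (1 - p%:R^-1) / (1 - p%:R `^ (- (b + 1))).

Lemma vladimirov_cst_ge0 (b : R) : 0 <= b -> 0 <= vladimirov_cst b.
Proof.
move=> b0; have p1 : 1 <= p%:R :> R by rewrite ler1n prime_gt0.
rewrite /vladimirov_cst divr_ge0 // subr_ge0.
  by rewrite invf_le1 // (lt_le_trans _ p1).
by rewrite -[leRHS](powRr0 p%:R) ler_powR // oppr_le0 addr_ge0.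
Qed.

(** The constant added off 0 is nonnegative. The point 0 is excluded because for [b > 0] the symbol
    vanishes there while the bracket is 1. *)
Lemma vladimirov_symbol_ge b xi : xi != 0 ->
  bracket R xi ^+ b <= vladimirov_symbol b%:R xi.
Proof.
move=> xi0; rewrite /vladimirov_symbol pdual_abs_bracket // powR_mulrn; last first.
  by rewrite (le_trans ler01) ?bracket_ge1.
rewrite lerDl mulr_ge0 //; last by rewrite subr_ge0 lern1 leq_b1.
exact: vladimirov_cst_ge0.
Qed.

(** The added constant is absorbed because the bracket is at least 1. *)
Lemma vladimirov_symbol_le b xi :
  `|vladimirov_symbol b%:R xi| <= (1 + vladimirov_cst b%:R) * bracket R xi `^ b%:R.
Proof.
have K0 := @vladimirov_cst_ge0 b%:R (ler0n _ _).
have br1 := bracket_ge1 R xi; have br0 : 0 <= bracket R xi by rewrite (le_trans ler01).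
have brb : 1 <= bracket R xi `^ b%:R.
  rewrite -[leLHS](powRr0 (bracket R xi)) ler_powR //.
have [e|xi0] := eqVneq xi 0.
  subst xi.
  rewrite /vladimirov_symbol eqxx subrr mulr0 addr0 pdual_absE // eqxx.
  apply: (@le_trans _ _ 1); last by rewrite mulr_ege1 ?lerDl.
  (* For [b = 0] the convention that 0 to the power 0 is 1 makes the symbol 1 at 0; for [b > 0] it
     is 0. *)
  rewrite ger0_norm ?powR_ge0 //; case: (posnP b) => [->|b0].
    by rewrite powRr0.
  by rewrite powR0 // pnatr_eq0 -lt0n.
rewrite /vladimirov_symbol (negPf xi0) subr0 mulr1 pdual_abs_bracket //.
rewrite -/(vladimirov_cst _) ger0_norm; last by rewrite addr_ge0 ?powR_ge0.
by rewrite mulrDl mul1r lerD2l ler_peMr.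
Qed.

Lemma fourier_bound f (C : R) xi : cmeasurable f -> (forall x, cmod (f x) <= C) ->
  cmod (fourier mu f xi) <= C + C.
Proof.
move=> mf fC; apply: cmod_cintegral_le.
  apply: cmeasurableM => //; under eq_fun do rewrite -chiN //.
  exact: cmeasurable_chi.
by move=> x; rewrite cmodM -chiN // cmod_chi // mulr1.
Qed.

(** For [xi != 0] the coefficient of [D^b f] is bounded by [C + C] and is at least [bracket xi ^+ b]
    times that of [f] in modulus. At [xi = 0] the symbol of [D^b] vanishes and carries no
    information, so the bound [C0] on [f] itself is used. *)
Lemma fourier_decay f b (C0 C : R) xi : cmeasurable f ->
    (forall x, cmod (f x) <= C0) -> (0 < b)%N ->
    vladimirov_le mu b%:R f C ->
  cmod (fourier mu f xi) * bracket R xi ^+ b <= (C0 + C0) + (C + C).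
Proof.
move=> mf fC b0 [g]; rewrite /is_vladimirov pnatr_eq0 -[_ == _]negbK -lt0n b0 /=.
move=> [_ [mg _] gE] gC.
have C00 : 0 <= C0 + C0 by rewrite addr_ge0 // (le_trans _ (fC 0)) ?cmod_ge0.
have CC0 : 0 <= C + C by rewrite addr_ge0 // (le_trans _ (gC 0)) ?cmod_ge0.
have [->|xi0] := eqVneq xi 0.
  rewrite bracketE // (_ : dexp 0 = 0%N) ?expn0 ?expr1n ?mulr1; last first.
    by apply/eqP; rewrite dexp_eq0.
  by rewrite (le_trans (fourier_bound _ mf fC)) // lerDl.
apply: (@le_trans _ _ (C + C)); last by rewrite lerDr.
apply: le_trans (fourier_bound xi mg gC); rewrite gE cmodM cmod_real mulrC.
rewrite ler_wpM2r ?cmod_ge0 // (le_trans (vladimirov_symbol_ge b xi0)) //.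
exact: ler_norm.
Qed.

Lemma vladimirov_le_series b c (C : R) : abs_sums_le c C ->
    abs_sums_le (fun xi => (vladimirov_symbol b%:R xi)%:C%C * c xi) C ->
  vladimirov_le mu b%:R (fourier_series c) (C + C).
Proof.
(* [D^0] is the identity by convention and not the multiplier of symbol [vladimirov_symbol 0], whose
   value off 0 is 2; hence a witness of its own for [b = 0]. *)
move=> cC vcC; case: (posnP b) => [b0|b0].
  exists (fourier_series c); first by rewrite /is_vladimirov b0 eqxx.
  exact: (cmod_fourier_series p_prime cC).
exists (fourier_series (fun xi => (vladimirov_symbol b%:R xi)%:C%C * c xi)).
  rewrite /is_vladimirov pnatr_eq0 -[_ == _]negbK -lt0n b0 /=; split.
  - apply: (@L2_bounded _ _ _ _ (C + C)).
      exact: (cmeasurable_fourier_series p_prime cC).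
    exact: (cmod_fourier_series p_prime cC).
  - apply: (@L2_bounded _ _ _ _ (C + C)).
      exact: (cmeasurable_fourier_series p_prime vcC).
    exact: (cmod_fourier_series p_prime vcC).
  - move=> xi; rewrite (fourier_fourier_series p_prime vcC) //.
    by rewrite (fourier_fourier_series p_prime cC).
exact: (cmod_fourier_series p_prime vcC).
Qed.

Lemma vladimirov_le_mono b f (C C' : R) : C <= C' ->
  vladimirov_le mu b%:R f C -> vladimirov_le mu b%:R f C'.
Proof. by move=> CC' [g fg gC]; exists g => // x; exact: le_trans (gC x) CC'. Qed.

End Vladimirov.

(** * Symbols, matrices, and the two inclusions *)

Section Operators.
Variables (R : realType) (p : nat).
Hypothesis p_prime : prime p.
Variable mu : probability (padic_int p) R.
Hypothesis mu_haar : is_haar mu.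
Implicit Types (sigma : padic_int p -> pdual p -> R[i]) (xi eta : pdual p).
Implicit Types (s : seq (R[i] * pdual p)) (T : dd_operator mu).

Definition trig_poly s : padic_int p -> R[i] :=
  fun x => \sum_(c <- s) c.1 * chi R c.2 x.

Lemma Hinf_trig_poly s : Hinf (trig_poly s).
Proof. by exists s. Qed.

Lemma chi_trig_poly xi : chi R xi = trig_poly [:: (1, xi)].
Proof. by apply/funext => x; rewrite /trig_poly big_seq1 mul1r. Qed.

Lemma pseudo_diff_trig_poly sigma s x :
  pseudo_diff mu sigma (trig_poly s) x =
  \sum_(c <- s) c.1 * (sigma x c.2 * chi R c.2 x).
Proof.
(* A character may occur several times in [s]; Fourier coefficients collect the occurrences, and the
   sum over the dual is supported in this duplicate-free list. *)
pose r := undup [seq c.2 | c <- s].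
have fE xi : fourier mu (trig_poly s) xi = \sum_(c <- s) c.1 * (c.2 == xi)%:R.
  rewrite fourier_sum //; last first.
    by move=> c; apply: cintegrableZ; exact: cintegrable_chi.
  apply: eq_bigr => c _.
  by rewrite (fourierZ p_prime _ _ (cintegrable_chi p_prime mu c.2)) fourier_chi.
rewrite /pseudo_diff (fsbigE r) ?undup_uniq //; last first.
  move=> xi _; rewrite mem_undup => xis; rewrite fE big_seq big1 ?mulr0 ?mul0r //.
  move=> c cs; case: eqP => [cxi|]; last by rewrite mulr0.
  by case/negP: xis; rewrite -cxi; apply: map_f.
under eq_bigl do rewrite in_setT.
under eq_bigr => xi _ do rewrite fE mulr_sumr mulr_suml.
rewrite exchange_big /= big_seq [RHS]big_seq; apply: eq_bigr => c cs.
rewrite (bigD1_seq c.2) ?undup_uniq ?mem_undup ?map_f //= eqxx mulr1 big1.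
  by rewrite addr0 mulrCA mulrA.
by move=> xi; rewrite eq_sym => /negPf ->; rewrite !mulr0 mul0r.
Qed.

(** The operator is linear only up to null sets; a trigonometric polynomial involves finitely many
    characters, so finitely many null sets are discarded. *)
Lemma op_act_trig_poly T sigma s :
    (forall xi, ae_equal mu (T (chi R xi)) (fun x => sigma x xi * chi R xi x)) ->
  ae_equal mu (T (trig_poly s)) (pseudo_diff mu sigma (trig_poly s)).
Proof.
move=> Tchi; suff : ae_equal mu (T (trig_poly s)) (fun x =>
    \sum_(c <- s) c.1 * (sigma x c.2 * chi R c.2 x)).
  by apply: filterS => x ->; rewrite pseudo_diff_trig_poly.
have dom s' : op_dom T (trig_poly s') by exact/op_dom_Hinf/Hinf_trig_poly.
have chi_dom xi : op_dom T (chi R xi).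
  by rewrite chi_trig_poly.
elim: s => [|c s IHs].
  (* Linearity at [1 * 0 + 0] gives T 0 = T 0 + T 0 almost everywhere, hence T 0 = 0. *)
  have := op_act_linear 1 (dom [::]) (dom [::]).
  rewrite (_ : (fun x => 1 * trig_poly [::] x + trig_poly [::] x) = trig_poly [::]).
    apply: filterS => x /eqP; rewrite mul1r -subr_eq0 opprD addNKr oppr_eq0.
    by move=> /eqP ->; rewrite big_nil.
  by apply/funext => x; rewrite /trig_poly big_nil mul1r addr0.
have := op_act_linear c.1 (chi_dom c.2) (dom s).
rewrite (_ : (fun x => c.1 * chi R c.2 x + trig_poly s x) = trig_poly (c :: s)).
  apply: filterS3 IHs (Tchi c.2) => x.
  by move=> IH Tc ->; rewrite IH Tc big_cons.
by apply/funext => x; rewrite /trig_poly big_cons.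
Qed.

Lemma assoc_matrix_fourier T sigma xi eta :
    cmeasurable (sigma^~ eta) ->
    ae_equal mu (T (chi R eta)) (fun x => sigma x eta * chi R eta x) ->
  assoc_matrix T xi eta = fourier mu (sigma^~ eta) (xi - eta).
Proof.
move=> ms Ts; have mchi zeta := @cmeasurable_chi R p p_prime zeta.
have mchiJ zeta : cmeasurable (fun x : padic_int p => (chi R zeta x)^*).
  rewrite (_ : (fun x => _) = chi R (- zeta)) //.
  by apply/funext => x; rewrite chiN.
have [mT _] : L2 mu (T (chi R eta)).
  apply: op_act_L2; rewrite chi_trig_poly; exact/op_dom_Hinf/Hinf_trig_poly.
apply: cintegral_ae.
- exact: cmeasurableM.
- exact: cmeasurableM.
apply: filterS Ts => x ->; rewrite -mulrA -!chiN // -chiDl //.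
by rewrite opprB.
Qed.

(** The dual is countable and discrete, so a preimage is a countable union of rectangles, one for
    each [xi]. *)
Lemma cmeasurable_countable (h : pdual p -> padic_int p -> R[i]) :
  (forall xi, cmeasurable (h xi)) ->
  cmeasurable (fun z : padic_int p * pdual p => h z.2 z.1).
Proof.
have key (k : pdual p -> padic_int p -> R) :
    (forall xi, measurable_fun setT (k xi)) ->
    measurable_fun setT (fun z : padic_int p * pdual p => k z.2 z.1).
  move=> mk _ B mB; rewrite setTI.
  rewrite [X in measurable X](_ : _ = \bigcup_xi ((k xi @^-1` B) `*` [set xi])).
    apply: countable_bigcupT_measurable => // xi.
    by apply: measurableX => //; rewrite -[X in measurable X]setTI; exact: mk.
  apply/seteqP; split=> [[x xi] /= kB|[x xi] [eta _ [/= kB ->]]] //.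
  by exists xi.
by move=> mh; split; [apply: (key (fun xi x => complex.Re (h xi x)))|
  apply: (key (fun xi x => complex.Im (h xi x)))] => xi; case: (mh xi).
Qed.

Lemma cmeasurable_section sigma xi :
  cmeasurable (fun z : padic_int p * pdual p => sigma z.1 z.2) ->
  cmeasurable (sigma^~ xi).
Proof.
have mpair : measurable_fun [set: padic_int p] (fun x => (x, xi)).
  by apply: measurable_fun_pair.
by move=> [m1 m2]; split; [exact: (measurableT_comp m1 mpair)|
  exact: (measurableT_comp m2 mpair)].
Qed.

Lemma schur_of_Op T r : 0 <= r -> Op mu (symbol_class mu 0 0 0) T ->
  schur_class mu r T.
Proof.
move=> r0 [sigma [msigma _ sigma_le] Tsigma].
(* Of the [k + 2] powers of the bracket gained from [D^b], the [k > r] first absorb the Schur weight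
   and the last two leave the summable factor. *)
pose k := (Num.truncn r).+1; pose b := (k + 2)%N.
have ms xi : cmeasurable (sigma^~ xi) by exact: cmeasurable_section.
have Tchi xi : ae_equal mu (T (chi R xi)) (fun x => sigma x xi * chi R xi x).
  have := Tsigma _ (Hinf_trig_poly [:: (1, xi)]); rewrite -chi_trig_poly.
  apply: filterS => x ->; rewrite chi_trig_poly pseudo_diff_trig_poly.
  by rewrite big_seq1 mul1r -chi_trig_poly.
have [C0 C00 H0] := sigma_le 0%N; have [C Cgt H] := sigma_le b.
(* The estimate for [D^0] is a bound on the symbol at every point; [fourier_decay] uses it for the
   coefficient at 0, that is, for the diagonal of the matrix. *)
have s0 xi x : cmod (sigma x xi) <= C0.
  have [g] := H0 xi; rewrite /is_vladimirov eqxx => -> /(_ x).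
  by rewrite mul0r addr0 powRr0 mulr1.
apply: (@schur_of_decay _ _ p_prime _ _ ((C0 + C0) + (C + C))) => //.
  by rewrite !addr_ge0 // ltW.
move=> xi eta; rewrite (assoc_matrix_fourier xi (ms eta) (Tchi eta)).
set z := xi - eta; have br1 := bracket_ge1 R z.
have br0 : 0 < bracket R z by exact: lt_le_trans ltr01 br1.
have := H eta; rewrite mul0r addr0 powRr0 mulr1 => Hb.
have b0 : (0 < b)%N by rewrite /b addn2.
rewrite ler_pdivlMr ?exprn_gt0 //.
apply: le_trans (fourier_decay p_prime z (ms eta) (s0 eta) b0 Hb).
rewrite -mulrA ler_wpM2l ?cmod_ge0 // /b exprD ler_wpM2r ?exprn_ge0 ?(ltW br0) //.
rewrite -[leRHS]powR_mulrn ?(ltW br0) // ler_powR //.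
by rewrite ltW // truncnS_gt.
Qed.

Lemma Op_of_schur T : (forall r, 0 <= r -> schur_class mu r T) ->
  Op mu (symbol_class mu 0 0 0) T.
Proof.
(* The Fourier coefficient at [zeta] of the product of [T (chi xi)] and the conjugate of [chi xi],
   hence of the symbol to be built. *)
move=> schurT; pose c xi zeta := assoc_matrix T (xi + zeta) xi.
pose v b zeta := vladimirov_symbol (p:=p) b%:R zeta : R.
have col (r : R) : 0 <= r -> exists C, forall xi,
    sums_le (fun zeta => cmod (c xi zeta) * bracket R zeta `^ r) C.
  move=> /schurT/schur_column[C HC]; exists C => xi s us.
  have uxs : uniq [seq xi + zeta | zeta <- s] by rewrite map_inj_uniq //; exact: addrI.
  apply: le_trans (HC xi _ uxs); rewrite big_map; apply: ler_sum => zeta _.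
  by rewrite [xi + zeta - xi]addrAC subrr add0r.
have colb b : exists2 C, 0 < C & forall xi, abs_sums_le (c xi) C /\
    abs_sums_le (fun zeta => (v b zeta)%:C%C * c xi zeta) C.
  have [C HC] := col b%:R (ler0n _ _).
  have C0 : 0 <= C by have := HC 0 [::] isT; rewrite big_nil.
  have K0 : 0 <= vladimirov_cst p b%:R :> R by exact: vladimirov_cst_ge0.
  pose K : R := 1 + vladimirov_cst p b%:R.
  have KC : C <= K * (C + 1).
    by rewrite (@le_trans _ _ (C + 1)) ?lerDl // ler_peMl ?addr_ge0 ?lerDl.
  (* [K] is the factor of [vladimirov_symbol_le], at least 1, so one constant serves both families;
     adding 1 keeps it positive when [C = 0]. *)
  exists (K * (C + 1)); first by apply: mulr_gt0; rewrite ?/K; lra.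
  move=> xi; split=> s us; apply: (@le_trans _ _ (\sum_(zeta <- s) K *
      (cmod (c xi zeta) * bracket R zeta `^ b%:R))).
  - apply: ler_sum => zeta _; rewrite mulrCA ler_peMr ?cmod_ge0 //.
    rewrite mulr_ege1 ?lerDl // -[leLHS](powRr0 (bracket R zeta)).
    by rewrite ler_powR ?bracket_ge1.
  - rewrite -mulr_sumr ler_wpM2l ?addr_ge0 // (le_trans (HC xi s us)) //.
    by rewrite lerDl.
  - apply: ler_sum => zeta _; rewrite cmodM cmod_real mulrCA mulrC.
    rewrite ler_wpM2l ?cmod_ge0 //; exact: vladimirov_symbol_le.
  - rewrite -mulr_sumr ler_wpM2l ?addr_ge0 // (le_trans (HC xi s us)) //.
    by rewrite lerDl.
exists (fun x xi => fourier_series (c xi) x).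
  split.
  - apply: (cmeasurable_countable (h := fun xi => fourier_series (c xi))) => xi.
    have [C _ /(_ xi)[cC _]] := colb 0%N.
    exact: (cmeasurable_fourier_series p_prime cC).
  (* The coefficients of a difference of two symbols have absolute sums at most [C + C], and
     [vladimirov_le_series] doubles this. *)
  - move=> alpha b; have [C C0 HC] := colb b; exists (C + C + (C + C)).
      by rewrite !addr_gt0.
    move=> xi eta _; have [h1 h1v] := HC xi; have [h2 h2v] := HC (xi + eta).
    rewrite !mul0r subr0 addr0 powRr0 mulr1.
    rewrite (_ : (fun x => _) =
        fourier_series (fun zeta => c (xi + eta) zeta - c xi zeta)); last first.
      by apply/funext => x; rewrite (fourier_seriesB p_prime x h2 h1).
    (* At [eta = 0] the right-hand side is 0 as soon as [alpha > 0], so the zero coefficients must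
       be given the bound 0 exactly. *)
    have [->|eta0] := eqVneq eta 0.
      have null (a : pdual p -> R[i]) : (forall zeta, a zeta = 0) -> abs_sums_le a 0.
        by move=> a0 s us; rewrite big1 // => zeta _; rewrite a0 cmod0.
      apply: (@vladimirov_le_mono _ _ _ _ _ (0 + 0)).
        by rewrite addr0 mulr_ge0 ?addr_ge0 ?(ltW C0) ?exprn_ge0 // pdual_absE // eqxx.
      apply: vladimirov_le_series => //; apply: null => zeta.
        by rewrite addr0 subrr.
      by rewrite addr0 subrr mulr0.
    apply: (@vladimirov_le_mono _ _ _ _ _ (C + C + (C + C))).
      by rewrite ler_peMr ?exprn_ege1 ?pdual_abs_ge1 ?addr_ge0 ?(ltW C0).
    apply: vladimirov_le_series => //; first exact: abs_sums_leB.
    move=> s us; apply: le_trans (abs_sums_leB h2v h1v us).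
    by under eq_bigr do rewrite mulrBr.
  - move=> b; have [C C0 HC] := colb b; exists (C + C); first by rewrite addr_gt0.
    move=> xi; rewrite mul0r addr0 powRr0 mulr1; have [h1 h1v] := HC xi.
    exact: vladimirov_le_series.
move=> f [s ->]; apply: op_act_trig_poly => xi.
have [C _ /(_ xi)[cC _]] := colb 0%N.
have LT : L2 mu (T (chi R xi)).
  apply: op_act_L2; rewrite chi_trig_poly; exact/op_dom_Hinf/Hinf_trig_poly.
(* Both sides have the coefficients [c xi]; multiplying back by [chi xi], of modulus 1, recovers
   [T (chi xi)] almost everywhere. *)
have : ae_equal mu (fun x => T (chi R xi) x * (chi R xi x)^*)
    (fourier_series (c xi)).
  apply: (fourier_inj p_prime) => //.
  - by apply: cintegrable_fourier => //; exact: L2_cintegrable.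
  - apply: (@cintegrable_bounded _ _ _ _ (C + C)).
      exact: (cmeasurable_fourier_series p_prime cC).
    exact: (cmod_fourier_series p_prime cC).
  - move=> zeta; rewrite (fourier_fourier_series p_prime cC) //.
    congr cintegral; apply/funext => x.
    by rewrite -!chiN // -mulrA -chiDl // opprD.
apply: filterS => x <-.
by rewrite -mulrA -chiN // -chiDl // addNr chi0 // mulr1.
Qed.

End Operators.

Theorem proposition6p5 (R : realType) (p : nat) (p_prime : prime p)
    (mu : probability (padic_int p) R) (mu_haar : is_haar mu) :
  (forall T : dd_operator mu,
     Op mu (symbol_class mu 0 0 0) T <->
     (\bigcap_(r in [set r : R | 0 <= r]) schur_class mu r) T) /\
  Op mu (symbol_class mu 0 0 0) =
    \bigcap_(r in [set r : R | 0 <= r]) schur_class mu r.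
Proof.
have H (T : dd_operator mu) : Op mu (symbol_class mu 0 0 0) T <->
    (\bigcap_(r in [set r : R | 0 <= r]) schur_class mu r) T.
  split=> [OpT r r0|schurT]; first exact: schur_of_Op.
  by apply: Op_of_schur => // r r0; exact: schurT.
by split=> //; apply/seteqP; split=> T /H.
Qed.
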